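(* Let $T>0$, and let $f$ be a $C^1$ solution on $[0,T]\times\mathbb{R}^2$ of the one-dimensional Vlasov-Poisson system $$\partial_t f + v\,\partial_x f - E\,\partial_v f = 0,\qquad \rho(t,x)=\int_{\mathbb{R}} (F(v)-f(t,x,v))\,dv,$$ $$E(t,x)=\frac12\left(\int_{-\infty}^x \rho(t,y)\,dy-\int_x^\infty \rho(t,y)\,dy\right),\qquad f(0,x,v)=f_0(x,v).$$ Assume that: (I) there is $R>0$ such that $f_0(x,v)=F(v)$ for all $|x|>R$ and all $v\in\mathbb{R}$, where $F\in C^1_c(\mathbb{R})$ is even and nonnegative, and $f_0\in C^1(\mathbb{R}^2)$ is nonnegative and compactly supported in $v$, i.e. there is $P>0$ with $f_0(x,v)=0$ for all $x\in\mathbb{R}$ and all $|v|>P$; (II) there is $C^{(1)}>0$ such that $\int_0^T\|E(\tau)\|_\infty\,d\tau\le C^{(1)}$. Let $Q_g(t)$, $R(t)$ and the characteristics $X(s,t,x,v)$, $V(s,t,x,v)$ be as defined in the context. Then for every $t\in[0,T]$ and every $x\in\mathbb{R}$ with $|x|>R(t)$: 1. $\rho(t,x)=0$. 2. For all $s\in[0,t]$ and all $v$ with $|v|\le Q_g(t)$, $\displaystyle \frac{\partial V}{\partial v}(s,t,x,v)=1.$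
   Context: Given functions are $F:\mathbb{R}\to[0,\infty)$ and $f_0:\mathbb{R}^2\to[0,\infty)$; the unknowns are $f:[0,T]\times\mathbb{R}\times\mathbb{R}\to\mathbb{R}$ and $E:[0,T]\times\mathbb{R}\to\mathbb{R}$. Here $t$ is time, $x$ is space, $v$ is momentum, and $\|E(\tau)\|_\infty=\sup_{x\in\mathbb{R}}|E(\tau,x)|$. A solution means that all relations of the system hold (in particular the integrals defining $\rho$ and $E$ make sense). The characteristics $X(s,t,x,v)$, $V(s,t,x,v)$ are defined by $$\partial_s X(s,t,x,v)=V(s,t,x,v),\quad \partial_s V(s,t,x,v)=-E(s,X(s,t,x,v)),\quad X(t,t,x,v)=x,\quad V(t,t,x,v)=v.$$ Put $g(t,x,v)=F(v)-f(t,x,v)$ and, for $t\in[0,T]$, $$Q_g(t)=\sup\{|v| : \exists\, x\in\mathbb{R},\ \tau\in[0,t]\text{ such that } g(\tau,x,v)\neq 0\}$$ (a supremum of a subset of $[0,\infty)$, equal to $0$ if the set is empty), and, with $R$ the constant of assumption (I), $$R(t)=R+tQ_g(t)+\int_0^t\int_\tau^t\|E(s)\|_\infty\,ds\,d\tau.$$ *)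

(* Defs.v *)
(* All integrals are Lebesgue integrals.  The unknowns f and E are total
   functions, of which only the values at times in [0, T] matter. *)
From HB Require Import structures.
From mathcomp Require Import all_boot all_order all_algebra.
From mathcomp Require Import all_classical all_reals all_analysis.

Set Implicit Arguments.
Unset Strict Implicit.
Unset Printing Implicit Defensive.

Import Order.TTheory GRing.Theory Num.Theory.
Import numFieldNormedType.Exports.

Local Open Scope classical_set_scope.
Local Open Scope ring_scope.

Section VlasovPoisson.
Context {R : realType}.
Implicit Types (T C r t : R) (F : R -> R) (f : R -> R -> R -> R).
Implicit Types (E : R -> R -> R).
Implicit Types (X V : R -> R -> R -> R -> R).

Local Notation mu := (@lebesgue_measure R).

(* One-sided at the endpoints when A is a closed interval. *)
Definition has_derivative_within (A : set R) (h : R -> R) (a l : R) : Prop :=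
  (fun y => (h y - h a) / (y - a)) @ within A a^' --> l.

Definition C1c F : Prop :=
  [/\ forall v, derivable F v 1,
      continuous (derive1 F)
    & compact (closure [set v | F v != 0])].

Definition C1_plane (f0 : R -> R -> R) : Prop :=
  exists gx gv : R -> R -> R,
    [/\ forall x v : R, is_derive x 1 (fun y => f0 y v) (gx x v),
        forall x v : R, is_derive v 1 (fun w => f0 x w) (gv x v),
        continuous (fun p : R * R => gx p.1 p.2)
      & continuous (fun p : R * R => gv p.1 p.2)].

Definition time_strip T : set (R * R * R) := [set p | `[0, T]%classic p.1.1].

(* f is C^1 on [0, T] x R^2, with partial derivatives ft, fx, fv. *)
Definition C1_strip_with T f (ft fx fv : R -> R -> R -> R) : Prop :=
  [/\ forall t x v, 0 <= t <= T ->
        [/\ has_derivative_within `[0, T] (fun s => f s x v) t (ft t x v),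
            is_derive x 1 (fun y => f t y v) (fx t x v)
          & is_derive v 1 (fun w => f t x w) (fv t x v)],
      {within time_strip T,
        continuous (fun p : R * R * R => ft p.1.1 p.1.2 p.2)},
      {within time_strip T,
        continuous (fun p : R * R * R => fx p.1.1 p.1.2 p.2)}
    & {within time_strip T,
        continuous (fun p : R * R * R => fv p.1.1 p.1.2 p.2)}].

Definition pert F f : R -> R -> R -> R := fun t x v => F v - f t x v.

Definition rho F f t x : R := \int[mu]_(v in [set: R]) pert F f t x v.

(* The two integrability fields say that the integrals defining rho and E
   make sense. *)
Record VP_solution T F (f0 : R -> R -> R) f E : Prop := {
  VP_vlasov : exists ft fx fv,
    C1_strip_with T f ft fx fv /\
    forall t x v, 0 <= t <= T ->
      ft t x v + v * fx t x v - E t x * fv t x v = 0;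
  VP_pert_integrable : forall t x, 0 <= t <= T ->
    mu.-integrable [set: R] (fun v => (pert F f t x v)%:E);
  VP_rho_integrable : forall t, 0 <= t <= T ->
    mu.-integrable [set: R] (fun y => (rho F f t y)%:E);
  VP_field : forall t x, 0 <= t <= T ->
    E t x = 2^-1 * ((\int[mu]_(y in `]-oo, x]) rho F f t y)
                    - (\int[mu]_(y in `[x, +oo[) rho F f t y));
  VP_init : forall x v, f 0 x v = f0 x v
}.

(* For each (t, x, v), the curve s |-> (X s t x v, V s t x v) is a classical
   solution on [0, T] passing through (x, v) at time t. *)
Definition characteristics T E X V : Prop :=
  forall t x v, 0 <= t <= T ->
    [/\ X t t x v = x,
        V t t x v = v
      & forall s, 0 <= s <= T ->
          has_derivative_within `[0, T] (fun s' => X s' t x v) s (V s t x v) /\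
          has_derivative_within `[0, T] (fun s' => V s' t x v) s
            (- E s (X s t x v))].

Definition supnorm (h : R -> R) : \bar R :=
  ereal_sup [set `|h x|%:E | x in [set: R]].

(* The maximum with 0 makes the supremum of the empty set 0 rather than -oo. *)
Definition Qg F f t : \bar R :=
  Order.max 0%E
    (ereal_sup [set `|v|%:E | v in
      [set v | exists x tau, 0 <= tau <= t /\ pert F f tau x v != 0]]).

Definition Rad r F f E t : \bar R :=
  (r%:E + t%:E * Qg F f t
   + \int[mu]_(tau in `[0%R, t]) \int[mu]_(s in `[tau, t]) supnorm (E s))%E.

Definition assumptionI r F (f0 : R -> R -> R) : Prop :=
  [/\ 0 < r,
      forall x v, r < `|x| -> f0 x v = F v,
      [/\ C1c F, forall v, F (- v) = F v & forall v, 0 <= F v]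
    & [/\ C1_plane f0, forall x v, 0 <= f0 x v
        & exists2 P : R, 0 < P & forall x v, P < `|v| -> f0 x v = 0]].

Definition assumptionII C T E : Prop :=
  [/\ 0 < C,
      mu.-integrable `[0, T] (fun tau => supnorm (E tau))
    & (\int[mu]_(tau in `[0%R, T]) supnorm (E tau) <= C%:E)%E].

End VlasovPoisson.

(* Main.v *)
Require Import Defs.
From mathcomp Require Import all_boot all_order all_algebra.
From mathcomp Require Import all_classical all_reals all_analysis.
From mathcomp Require Import ring lra.

(** Fix t > 0 and |x| > R(t).  Then q = Q_g(t) is finite, and on [0, t] both F
    and f vanish for large |v|.

    A characteristic through (t, x, v) with |v| <= q moves in space by at most
    t q plus the double integral of the sup norm of E (space_displacement), so
    followed backwards it stays in the outer region and starts at |X(0)| > r,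
    where f0 = F.  As f is constant along characteristics
    (constant_along_characteristics), f(t, x, v) = F(V(0, t, x, v)) there.

    The field need not vanish in the outer region, since the total charge is not
    assumed to be zero.  The claim to prove is instead that on each of the two
    components of the outer region E(t, .) is constant in x
    (field_constant_outer).  Both conclusions follow: the density is the
    x-derivative of E, hence rho = 0; and two characteristics through (t, x)
    feel the same force, so V(s, t, x, w) - V(s, t, x, v) = w - v.

    Constancy is proved by comparing two points x, y of the same component.  At
    time 0 the density vanishes between them, so E(0, x) = E(0, y).  Integrating
    the Vlasov equation in v and x gives conservation of charge: the derivative
    of E(t, x) - E(t, y) is the integral of v (f(t, x, v) - f(t, y, v)) over v
    (is_derive_charge, field_increment_time).  For |v| > q both values of f are
    F(v); for |v| <= q their difference is at most the Lipschitz constant of F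
    times the difference of the momenta V(0), which the differences of E at
    earlier times control.  This is a closed linear loop of Gronwall type: in
    the norm weighted by exp(- l s) with l large, a bound A on the oscillation
    of f improves to A / 2 (spread_half), hence the oscillation is zero.

    The displacement bounds integrate E along trajectories, which needs E to be
    continuous in time.  This is derived from the equation: where the
    v-derivative of f is nonzero, E is a quotient of continuous functions
    (continuous_field). *)

Set Implicit Arguments.
Unset Strict Implicit.
Unset Printing Implicit Defensive.

Import Order.TTheory GRing.Theory Num.Theory.
Import numFieldNormedType.Exports.

Local Open Scope classical_set_scope.
Local Open Scope ring_scope.

(** * Derivatives within a closed interval *)

Section DifferenceQuotients.
Context {R : realType}.
Implicit Types (a b s t x y v : R) (h : R -> R).

(** Stating both notions of derivative as linear approximation up to
    e * |y - a| removes the quotients and the punctured filters, and makes the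
    passage between them immediate. *)
Lemma has_derivative_withinP (A : set R) h a l :
  has_derivative_within A h a l <->
  forall e, 0 < e -> exists2 d, 0 < d & forall y, A y -> `|y - a| < d ->
    `|h y - h a - l * (y - a)| <= e * `|y - a|.
Proof.
split=> [/cvgrPdist_le /= hl e e0|hl].
  have [d /= d0 hd] := hl e e0.
  exists d => // y Ay yd.
  have [->|ya] := eqVneq y a; first by rewrite !subrr mulr0 subrr normr0 mulr0.
  have := hd y; rewrite /ball_/= distrC => /(_ yd ya Ay) {}hd.
  have ya0 : y - a != 0 by rewrite subr_eq0.
  rewrite -[l * _](mulfK ya0) -[h y - h a](mulfVK ya0) mulfK // -mulrBl normrM.
  by rewrite distrC ler_wpM2r.
apply/cvgrPdist_le => /= e e0.
have [d d0 hd] := hl e e0.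
exists d => //= y; rewrite /ball_/= distrC => yd ya Ay.
have ya0 : y - a != 0 by rewrite subr_eq0.
have := hd y Ay yd.
rewrite -{1}[h y - h a](mulfVK ya0) -mulrBl normrM distrC.
by rewrite ler_pM2r // normr_gt0.
Qed.

Lemma is_derive1P h x l :
  is_derive x 1 h l <->
  forall e, 0 < e -> exists2 d, 0 < d & forall y, `|y - x| < d ->
    `|h y - h x - l * (y - x)| <= e * `|y - x|.
Proof.
have E : is_derive x 1 h l <->
    (fun e : R => e^-1 *: (h (e *: 1 + x) - h x)) @ 0^' --> l.
  split=> [hl|hl].
    have /= := @ex_derive _ _ _ _ _ _ _ hl.
    rewrite -(@derive_val _ _ _ _ _ _ _ hl); exact.
  split; first by apply/cvg_ex; exists l.
  exact: cvg_lim.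
rewrite E; split=> [/cvgrPdist_le /= hl e e0|hl].
  have [d /= d0 hd] := hl e e0.
  exists d => // y yd.
  have [->|ya] := eqVneq y x; first by rewrite !subrr mulr0 subrr normr0 mulr0.
  have ya0 : y - x != 0 by rewrite subr_eq0.
  have := hd (y - x); rewrite /ball_/= sub0r normrN => /(_ yd ya0).
  rewrite /GRing.scale/= mulr1 subrK => {}hd.
  rewrite -[l * _](mulfK ya0) -[h y - h x](mulfVK ya0) mulfK // -mulrBl normrM.
  by rewrite distrC ler_wpM2r // mulrC.
apply/cvgrPdist_le => /= e e0.
have [d d0 hd] := hl e e0.
exists d => //= y; rewrite /ball_/= sub0r normrN => yd y0.
have := hd (y + x); rewrite addrK => /(_ yd).
rewrite /GRing.scale/= mulr1 -{1}[h (y + x) - h x](mulfVK y0) -mulrBl normrM.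
by rewrite distrC ler_pM2r ?normr_gt0 // mulrC.
Qed.

Lemma has_derivative_within_is_derive a b h s l :
  a < s < b -> has_derivative_within `[a, b] h s l -> is_derive s 1 h l.
Proof.
move=> /andP[sa sb] /has_derivative_withinP hl; apply/is_derive1P => e e0.
have [d d0 hd] := hl e e0.
exists (Num.min d (Num.min (s - a) (b - s))).
  by rewrite !lt_min d0 !subr_gt0 sa sb.
move=> y; rewrite !lt_min => /and3P[yd ya yb]; apply: hd => //.
rewrite /= in_itv/=.
by move: ya yb; rewrite !ltr_norml => /andP[? ?] /andP[? ?]; apply/andP; split; lra.
Qed.

Lemma is_derive_has_derivative_within (A : set R) h s l :
  is_derive s 1 h l -> has_derivative_within A h s l.
Proof.
move=> /is_derive1P hl; apply/has_derivative_withinP => e /hl[d d0 hd].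
by exists d => // y _; exact: hd.
Qed.

Lemma has_derivative_within_continuous a b h (h' : R -> R) :
  (forall s, a <= s <= b -> has_derivative_within `[a, b] h s (h' s)) ->
  {within `[a, b], continuous h}.
Proof.
move=> hh; apply/subspace_continuousP => s /=; rewrite in_itv/= => sab.
have /has_derivative_withinP/(_ 1 ltr01)[d d0 hd] := hh s sab.
apply/cvgrPdist_le => /= e e0.
have L0 : 0 < 1 + `|h' s| by rewrite ltr_pwDl.
exists (Num.min d (e / (1 + `|h' s|))); first by rewrite /= lt_min d0 divr_gt0.
move=> y /=; rewrite /ball_/= distrC lt_min => /andP[yd ye] yab.
have := hd y yab yd; rewrite mul1r => H.
have : `|h s - h y| <= (1 + `|h' s|) * `|y - s|.
  rewrite distrC mulrDl mul1r -normrM -lerBlDr.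
  exact: le_trans (lerB_dist _ _) H.
move=> /le_trans; apply.
by rewrite mulrC -ler_pdivlMr // ltW.
Qed.

Lemma mean_value_within a b s t h (h' : R -> R) :
  (forall y, a <= y <= b -> has_derivative_within `[a, b] h y (h' y)) ->
  a <= s -> s <= t -> t <= b ->
  exists2 c, s <= c <= t & h t - h s = h' c * (t - s).
Proof.
move=> hh as_ st tb.
have [||c] := @MVT_segment R h h' s t st.
- move=> x; rewrite in_itv/= => /andP[sx xt].
  have axb : a < x < b by rewrite (le_lt_trans as_) //= (lt_le_trans xt).
  apply: (has_derivative_within_is_derive axb); apply: hh.
  by move/andP: axb => [/ltW-> /ltW->].
- have := has_derivative_within_continuous hh.
  apply: continuous_subspaceW => x /=; rewrite !in_itv/= => /andP[sx xt].
  by rewrite (le_trans as_) //= (le_trans xt).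
by rewrite in_itv/= => ? ?; exists c.
Qed.

Lemma mean_value_within_near a b s t h (h' : R -> R) :
  (forall y, a <= y <= b -> has_derivative_within `[a, b] h y (h' y)) ->
  a <= s <= b -> a <= t <= b ->
  exists c, [/\ a <= c <= b, `|c - s| <= `|t - s| & h t - h s = h' c * (t - s)].
Proof.
move=> hh /andP[as_ sb] /andP[at_ tb]; have [st|/ltW ts] := leP s t.
  have [c /andP[sc ct] E] := mean_value_within hh as_ st tb.
  exists c; split => //; first by rewrite (le_trans as_) //= (le_trans ct).
  by rewrite !ger0_norm ?subr_ge0 // lerB.
have [c /andP[tc cs] E] := mean_value_within hh at_ ts sb.
exists c; split; first by rewrite (le_trans at_) //= (le_trans cs).
- by rewrite !ler0_norm ?subr_le0 // lerN2 lerB.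
- by rewrite -opprB E -mulrN opprB.
Qed.

Lemma mean_value_near s t h (h' : R -> R) :
  (forall y, is_derive y 1 h (h' y)) ->
  exists c, `|c - s| <= `|t - s| /\ h t - h s = h' c * (t - s).
Proof.
move=> hh.
have [|||c [_ ? ?]] := @mean_value_within_near (Num.min s t) (Num.max s t) s t h h'.
- by move=> y _; exact: is_derive_has_derivative_within.
- by rewrite ge_min lexx le_max lexx.
- by rewrite ge_min lexx le_max lexx !orbT.
- by exists c.
Qed.

Lemma has_derivative_withinB (A : set R) h k a l m :
  has_derivative_within A h a l -> has_derivative_within A k a m ->
  has_derivative_within A (fun y => h y - k y) a (l - m).
Proof.
move=> hl km; rewrite /has_derivative_within.
rewrite (_ : (fun y => _) =
  (fun y => (h y - h a) / (y - a)) \- (fun y => (k y - k a) / (y - a))).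
  exact: cvgB.
by apply/funext => y /=; rewrite -mulrBl; congr (_ / _); ring.
Qed.

End DifferenceQuotients.

(** * Integrals depending on a parameter *)

Section ParameterIntegrals.
Context {R : realType}.
Local Notation mu := (@lebesgue_measure R).
Implicit Types (a b s t x y v M : R) (h : R -> R).

Lemma continuous_itv_integrable a b h :
  {within `[a, b], continuous h} -> mu.-integrable `[a, b] (EFin \o h).
Proof.
by move=> ch; apply: continuous_compact_integrable => //; exact: segment_compact.
Qed.

Lemma continuous_integrable a b h :
  continuous h -> mu.-integrable `[a, b] (EFin \o h).
Proof. by move=> ch; exact/continuous_itv_integrable/continuous_subspaceT. Qed.

Lemma normr_Rintegral_le a b h M : a <= b ->
  mu.-integrable `[a, b] (EFin \o h) ->
  (forall y, a <= y <= b -> `|h y| <= M) ->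
  `|\int[mu]_(y in `[a, b]) h y| <= M * (b - a).
Proof.
move=> ab ih hM.
apply: (le_trans (le_normr_Rintegral _ ih)) => //.
have E : M * (b - a) = \int[mu]_(y in `[a, b]) M.
  rewrite Rintegral_cst //= lebesgue_measure_itv /= lte_fin.
  move: ab; rewrite le_eqVlt => /predU1P[->|->] //.
  by rewrite ltxx subrr.
rewrite E; apply: le_Rintegral => //.
- have /integrable_abse := ih; exact: eq_integrable.
- apply: continuous_integrable; exact: cst_continuous.
Qed.

Lemma Rintegral_within_derive a b h h' : a <= b ->
  {within `[a, b], continuous h} -> {within `[a, b], continuous h'} ->
  (forall y, a < y < b -> is_derive y 1 h (h' y)) ->
  \int[mu]_(y in `[a, b]) h' y = h b - h a.
Proof.
rewrite le_eqVlt => /predU1P[->|ab] ch ch' hh.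
  by rewrite set_itv1 Rintegral_set1 subrr.
have /(continuous_within_itvP h ab)[_ ca cb] := ch.
rewrite /Rintegral (continuous_FTC2 (F := h) ab ch') //.
  by split => // y; rewrite in_itv/= => /hh dy; exact: ex_derive.
by move=> y; rewrite in_itv/= => /hh dy; rewrite derive1E derive_val.
Qed.

Lemma Rintegral_derive a b h h' : a <= b -> continuous h' ->
  (forall y, is_derive y 1 h (h' y)) ->
  \int[mu]_(y in `[a, b]) h' y = h b - h a.
Proof.
move=> ab ch' hh; apply: Rintegral_within_derive => //.
- apply: derivable_within_continuous => y _; exact: (@ex_derive _ _ _ _ _ _ _ (hh y)).
- exact: continuous_subspaceT.
Qed.

Section Continuity.
Variables (A : topologicalType) (h : A -> R -> R) (a b : R).
Hypotheses (ab : a <= b).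
Hypothesis ch : continuous (fun p : A * R => h p.1 p.2).

Lemma continuous_section p : continuous (h p).
Proof.
move=> v; apply: (@continuous_comp _ _ _ (fun v => (p, v)) (fun q => h q.1 q.2)).
  by apply: (@cvg_pair _ _ _ _ (nbhs p) (nbhs v)); [exact: cvg_cst|exact: cvg_id].
exact: ch.
Qed.

(** By compactness of [a, b], continuity in the parameter is uniform in the
    integration variable; both continuity of the parameter integral and
    differentiation under the integral sign follow from it. *)
Lemma near_uniform p (e : R) : 0 < e ->
  \forall p' \near p, forall v, a <= v <= b -> `|h p' v - h p v| < e.
Proof.
move=> e0.
have /(iffLR (compact_near_coveringP _)) cov := @segment_compact R a b.
have {}cov := cov _ (nbhs p) (fun p' v => `|h p' v - h p v| < e) _;
  have : \forall p' \near p, `[a, b]%classic `<=` (fun v => `|h p' v - h p v| < e).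
  apply: cov.
  move=> v _ /=.
  have e2 : 0 < e / 2 by rewrite divr_gt0.
  have := @ch (p, v) => /cvgrPdist_lt/(_ _ e2)[[U W] /= [Up Wv] UW].
  exists (W, U) => // -[v' p'] /= [Wv' Up'].
  have H1 := UW (p', v') (conj Up' Wv').
  have H2 := UW (p, v') (conj (nbhs_singleton Up) Wv').
  rewrite /= in H1 H2.
  rewrite (splitr e) (le_lt_trans (ler_distD (h p v) _ _)) // ltrD //.
  by rewrite distrC.
by apply: filterS => p' H v vab; apply: H; rewrite /= in_itv.
Qed.

Lemma continuous_parameter_integral :
  continuous (fun p => \int[mu]_(v in `[a, b]) h p v).
Proof.
move=> p; apply/cvgrPdist_le => /= e e0.
have L0 : 0 < b - a + 1 by rewrite ltr_wpDl // subr_ge0.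
have := near_uniform p (divr_gt0 e0 L0); apply: filterS => p' H.
rewrite -RintegralB //; [|exact/continuous_integrable/continuous_section..].
have ic q q' : mu.-integrable `[a, b] (EFin \o (fun v => h q v - h q' v)).
  apply: continuous_integrable => v.
  by apply: cvgB; exact: continuous_section.
apply: (le_trans (normr_Rintegral_le (M := e / (b - a + 1)) ab (ic _ _) _)).
  by move=> v vab; rewrite distrC ltW // H.
by rewrite mulrAC ler_pdivrMr // ler_pM2l // lerDl.
Qed.

End Continuity.

(** The mean value theorem turns the difference quotient of the integrand into
    a value of h' at a nearby parameter, and near_uniform bounds the error
    uniformly in v. *)
Lemma is_derive_parameter_integral (h h' : R -> R -> R) a b lo hi s : a <= b ->
  (forall t, continuous (h t)) ->
  continuous (fun p : R * R => h' p.1 p.2) ->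
  (forall t v, lo < t < hi -> is_derive t 1 (fun t' => h t' v) (h' t v)) ->
  lo < s < hi ->
  is_derive s 1 (fun t => \int[mu]_(v in `[a, b]) h t v)
    (\int[mu]_(v in `[a, b]) h' s v).
Proof.
move=> ab ch ch' dh /andP[ls sh]; apply/is_derive1P => e e0.
have L0 : 0 < b - a + 1 by rewrite ltr_wpDl // subr_ge0.
have [d /= d0 hd] := near_uniform a b ch' s (divr_gt0 e0 L0).
exists (Num.min d (Num.min (s - lo) (hi - s))).
  by rewrite !lt_min d0 !subr_gt0 ls sh.
move=> y; rewrite !lt_min => /and3P[yd yl yh].
have [yl' yh'] : lo < y /\ y < hi.
  by move: yl yh; rewrite !ltr_norml => /andP[? ?] /andP[? ?]; split; lra.
have ih t : mu.-integrable `[a, b] (EFin \o h t) by exact: continuous_integrable.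
have ch's t : continuous (h' t) by exact: (continuous_section ch').
have ih' : mu.-integrable `[a, b] (EFin \o h' s) by exact: continuous_integrable.
rewrite -RintegralB // mulrC -RintegralZl //.
rewrite -RintegralB //; last 2 first.
- by apply: continuous_integrable => v; apply: cvgB; exact: ch.
- by apply: continuous_integrable => v; apply: cvgM; [exact: cvg_cst|exact: ch's].
apply: (le_trans (normr_Rintegral_le (M := e / (b - a + 1) * `|y - s|) ab _ _)).
- apply: continuous_integrable => v; apply: cvgB; first by apply: cvgB; exact: ch.
  by apply: cvgM; [exact: cvg_cst|exact: ch's].
- move=> v vab.
  have [c cs ->] : exists2 c, `|c - s| <= `|y - s| &
      h y v - h s v = h' c v * (y - s).
    have dv z : Num.min s y <= z <= Num.max s y ->
        has_derivative_within `[Num.min s y, Num.max s y] (h^~ v) z (h' z v).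
      move=> /andP[z1 z2]; apply: is_derive_has_derivative_within; apply: dh.
      apply/andP; split.
        by rewrite (lt_le_trans _ z1) // lt_min ls yl'.
      by rewrite (le_lt_trans z2) // gt_max sh yh'.
    have [||c [_ ? ?]] := @mean_value_within_near _ _ _ s y _ (h'^~ v) dv.
    - by rewrite ge_min lexx le_max lexx.
    - by rewrite ge_min lexx le_max lexx !orbT.
    - by exists c.
  rewrite [(y - s) * _]mulrC -mulrBl normrM ler_wpM2r // ltW //.
  by apply: hd => //; rewrite /ball_ /= distrC (le_lt_trans cs).
rewrite mulrAC ler_wpM2r // mulrAC ler_pdivrMr // ler_pM2l //.
by rewrite lerDl.
Qed.

End ParameterIntegrals.

(** * Differential calculus on the strip *)

Section StripCalculus.
Context {R : realType}.
Implicit Types (s t x y v T : R).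

(** Extending functions on [0, T] by constants makes the time endpoints ordinary
    points, so that continuity on the strip becomes plain continuity. *)
Definition clamp T s : R := Num.max 0 (Num.min s T).

Lemma clamp_itv T s : 0 <= T -> 0 <= clamp T s <= T.
Proof. by move=> T0; rewrite le_max lexx ge_max T0 ge_min lexx orbT. Qed.

Lemma clamp_id T s : 0 <= s <= T -> clamp T s = s.
Proof. by move=> /andP[s0 sT]; rewrite /clamp (min_idPl sT) (max_idPr s0). Qed.

Lemma continuous_clamp T : continuous (clamp T).
Proof.
move=> s; apply: (@continuous_max R _ (cst 0) (fun s => Num.min s T)).
  exact: cst_continuous.
apply: (@continuous_min R _ id (cst T)); first exact: cvg_id.
exact: cst_continuous.
Qed.

Lemma cvg_to_pair I (U W : topologicalType) (F : set_system I) (u : I -> U)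
    (w : I -> W) (a : U) (b : W) : Filter F ->
  u @ F --> a -> w @ F --> b -> (fun i => (u i, w i)) @ F --> (a, b).
Proof. by move=> FF ua wb; exact: (@cvg_pair _ _ _ F (nbhs a) (nbhs b)). Qed.

Lemma cvg_fst_at (U W : topologicalType) (p : U * W) : fst @ p --> p.1.
Proof. by move=> A A1; exists (A, setT) => /= [|q []//]; split => //; exact: filterT. Qed.

Lemma cvg_snd_at (U W : topologicalType) (p : U * W) : snd @ p --> p.2.
Proof. by move=> A A2; exists (setT, A) => /= [|q []//]; split => //; exact: filterT. Qed.

Lemma cvg_time_at (p : R * R * R) : (fun q : R * R * R => q.1.1) @ p --> p.1.1.
Proof. by apply: cvg_comp; [exact: cvg_fst_at|exact: cvg_fst_at]. Qed.

Lemma cvg_space_at (p : R * R * R) : (fun q : R * R * R => q.1.2) @ p --> p.1.2.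
Proof. by apply: cvg_comp; [exact: cvg_fst_at|exact: cvg_snd_at]. Qed.

Lemma cvg_clamp_at T (p : R * R * R) :
  (fun q : R * R * R => clamp T q.1.1) @ p --> clamp T p.1.1.
Proof. by apply: cvg_comp; [exact: cvg_time_at|exact: continuous_clamp]. Qed.

Lemma continuous_on_strip T (g : R -> R -> R -> R) : 0 <= T ->
  {within time_strip T, continuous (fun p : R * R * R => g p.1.1 p.1.2 p.2)} ->
  continuous (fun p : R * R * R => g (clamp T p.1.1) p.1.2 p.2).
Proof.
move=> T0 /subspace_continuousP cg p.
have strip q : time_strip T (clamp T q.1.1, q.1.2, q.2).
  by rewrite /time_strip /= in_itv/= clamp_itv.
have := cg _ (strip p) => /=.
have H : (fun q : R * R * R => (clamp T q.1.1, q.1.2, q.2)) @ p -->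
    (clamp T p.1.1, p.1.2, p.2).
  apply: (@cvg_to_pair _ _ _ (nbhs p)); last exact: cvg_snd_at.
  by apply: (@cvg_to_pair _ _ _ (nbhs p)); [exact: cvg_clamp_at|exact: cvg_space_at].
move=> cgp U Ug.
have H2 : \forall q \near p, time_strip T (clamp T q.1.1, q.1.2, q.2) ->
    U (g (clamp T q.1.1) q.1.2 q.2) by exact: (H _ (cgp U Ug)).
by apply: (filterS _ H2) => q; apply; exact: strip.
Qed.

Lemma cvg_closer I (F : set_system I) (u w : I -> R) (a : R) : Filter F ->
  u @ F --> a -> (\forall i \near F, `|w i - a| <= `|u i - a|) -> w @ F --> a.
Proof.
move=> FF /cvgrPdist_lt ua wu; apply/cvgrPdist_lt => e e0.
near=> i; rewrite distrC; apply: (@le_lt_trans _ _ `|u i - a|).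
  by near: i; exact: wu.
by rewrite distrC; near: i; exact: ua.
Unshelve. all: by end_near. Qed.

Section C1Strip.
Variables (T : R) (f ft fx fv : R -> R -> R -> R).
Hypothesis T0 : 0 <= T.
Hypothesis C1f : C1_strip_with T f ft fx fv.

(** Move first in time, then in x, then in v.  Only the time leg sees the
    one-sided derivatives. *)
Lemma strip_mean_value t x v t' x' v' : 0 <= t <= T -> 0 <= t' <= T ->
  exists p : R * R * R,
    [/\ 0 <= p.1.1 <= T, `|p.1.1 - t| <= `|t' - t|, `|p.1.2 - x| <= `|x' - x|,
     `|p.2 - v| <= `|v' - v| &
     f t' x' v' - f t x v = ft p.1.1 x' v' * (t' - t) + fx t p.1.2 v' * (x' - x)
       + fv t x p.2 * (v' - v)].
Proof.
move=> tT t'T; have [df _ _ _] := C1f.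
have [|c [cT ct Et]] :=
    @mean_value_within_near R 0 T t t' (fun s => f s x' v') (fun s => ft s x' v') _ tT t'T.
  by move=> y yT; have [] := df y x' v' yT.
have [|d [dx Ex]] := @mean_value_near R x x' (fun y => f t y v') (fun y => fx t y v').
  by move=> y; have [] := df t y v' tT.
have [|w [wv Ev]] := @mean_value_near R v v' (fun w => f t x w) (fun w => fv t x w).
  by move=> w; have [] := df t x w tT.
exists (c, d, w); split => //=; rewrite -Et -Ex -Ev; ring.
Qed.

(** Both the continuity of f and the chain rule along a curve follow from this
    linearization, whose coefficients converge to the partial derivatives. *)
Lemma cvg_strip_increment I (F : set_system I) (u y w : I -> R) t x v :
  Filter F -> 0 <= t <= T -> (\forall i \near F, 0 <= u i <= T) ->
  u @ F --> t -> y @ F --> x -> w @ F --> v ->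
  exists a b c : I -> R,
    [/\ a @ F --> ft t x v, b @ F --> fx t x v, c @ F --> fv t x v &
     \forall i \near F, f (u i) (y i) (w i) - f t x v =
       a i * (u i - t) + b i * (y i - x) + c i * (w i - v)].
Proof.
move=> FF tT uT ut yx wv; have [_ cft cfx cfv] := C1f.
have /choice[p Hp] : forall i, exists p : R * R * R, 0 <= u i <= T ->
    [/\ 0 <= p.1.1 <= T, `|p.1.1 - t| <= `|u i - t|, `|p.1.2 - x| <= `|y i - x|,
     `|p.2 - v| <= `|w i - v| &
     f (u i) (y i) (w i) - f t x v = ft p.1.1 (y i) (w i) * (u i - t)
       + fx t p.1.2 (w i) * (y i - x) + fv t x p.2 * (w i - v)].
  move=> i; have [uiT|_] := boolP (0 <= u i <= T); last by exists (0, 0, 0).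
  by have [p ?] := strip_mean_value x v (y i) (w i) tT uiT; exists p.
have p1 : (fun i => (p i).1.1) @ F --> t.
  by apply: cvg_closer ut _; apply: filterS uT => i /Hp[].
have p2 : (fun i => (p i).1.2) @ F --> x.
  by apply: cvg_closer yx _; apply: filterS uT => i /Hp[].
have p3 : (fun i => (p i).2) @ F --> v.
  by apply: cvg_closer wv _; apply: filterS uT => i /Hp[].
have cvg3 (g : R -> R -> R -> R) (k l m : I -> R) :
    {within time_strip T, continuous (fun p : R * R * R => g p.1.1 p.1.2 p.2)} ->
    k @ F --> t -> l @ F --> x -> m @ F --> v ->
    (fun i => g (clamp T (k i)) (l i) (m i)) @ F --> g t x v.
  move=> cg kt lx mv; have := @continuous_on_strip T g T0 cg (t, x, v).
  rewrite /continuous_at /= (clamp_id tT) => cgt.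
  apply: (@cvg_comp _ _ _ (fun i => (k i, l i, m i)) _ _ _ _ _ cgt).
  by apply: cvg_to_pair => //; exact: cvg_to_pair.
exists (fun i => ft (clamp T (p i).1.1) (y i) (w i)),
  (fun i => fx (clamp T t) (p i).1.2 (w i)), (fun i => fv (clamp T t) x (p i).2).
split.
- exact: cvg3.
- by apply: (cvg3 fx (cst t)) => //; exact: cvg_cst.
- by apply: (cvg3 fv (cst t) (cst x)) => //; exact: cvg_cst.
by apply: filterS uT => i /Hp[p1T _ _ _ ->]; rewrite !clamp_id.
Qed.

Lemma C1_strip_continuous :
  continuous (fun p : R * R * R => f (clamp T p.1.1) p.1.2 p.2).
Proof.
move=> q; set t := clamp T q.1.1.
have tT : 0 <= t <= T by exact: clamp_itv.
have u_cvg := @cvg_clamp_at T q; have y_cvg := @cvg_space_at q.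
have w_cvg := @cvg_snd_at _ _ q.
have [|a [b [c [ca cb cc E]]]] := @cvg_strip_increment _ _ _ _ _ t q.1.2 q.2 _ tT _ u_cvg y_cvg w_cvg.
  by apply: nearW => p; exact: clamp_itv.
have Z (k l : R * R * R -> R) (k0 l0 : R) : k @ q --> k0 -> l @ q --> l0 ->
    (fun p => k p * (l p - l0)) @ q --> 0.
  move=> kk ll; rewrite -[0](mulr0 k0) -[X in _ * X](subrr l0).
  by apply: cvgM => //; apply: cvgB => //; exact: cvg_cst.
have S' : (fun p => a p * (clamp T p.1.1 - t) + b p * (p.1.2 - q.1.2)
    + c p * (p.2 - q.2) + f t q.1.2 q.2) @ q --> 0 + 0 + 0 + f t q.1.2 q.2.
  apply: cvgD; last exact: cvg_cst.
  by apply: cvgD; [apply: cvgD|]; apply: Z; eassumption.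
rewrite !addr0 add0r in S'.
apply: cvg_trans S'; apply: near_eq_cvg; apply: filterS E => p /= E.
by rewrite /= -E subrK.
Qed.

Lemma strip_chain_rule (X V : R -> R) s X' V' : 0 <= s <= T ->
  has_derivative_within `[0, T] X s X' -> has_derivative_within `[0, T] V s V' ->
  has_derivative_within `[0, T] (fun y => f y (X y) (V y)) s
    (ft s (X s) (V s) + fx s (X s) (V s) * X' + fv s (X s) (V s) * V').
Proof.
move=> sT dX dV.
have id_cvg : id @ (within `[0, T] s^') --> s.
  move=> U /nbhs_dnbhs sU.
  suff : \forall y \near s^', `[0, T]%classic y -> U y by [].
  by near=> y => _; near: y.
have neq : \forall y \near within `[0, T] s^', y - s != 0.
  suff : \forall y \near s^', `[0, T]%classic y -> y - s != 0 by [].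
  by near=> y => _; rewrite subr_eq0; near: y; exact: nbhs_dnbhs_neq.
have cvg_of (h : R -> R) h' : has_derivative_within `[0, T] h s h' ->
    h @ (within `[0, T] s^') --> h s.
  move=> dh; rewrite /has_derivative_within in dh.
  have yz : (fun y => y - s) @ (within `[0, T] s^') --> 0.
    rewrite -[X in _ --> X](subrr s); apply: (@cvgB _ _ _ _ _ id (cst s)); last exact: cvg_cst.
    exact: id_cvg.
  have : (fun y => (h y - h s) / (y - s) * (y - s) + h s) @ (within `[0, T] s^')
      --> h' * 0 + h s.
    by apply: cvgD; [exact: cvgM|exact: cvg_cst].
  rewrite mulr0 add0r; apply: cvg_trans; apply: near_eq_cvg.
  by apply: filterS neq => y ys /=; rewrite mulfVK // subrK.
have [|a [b [c [ca cb cc E]]]] := @cvg_strip_increment _ (within `[0, T] s^') id X V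
    s (X s) (V s) _ sT _ id_cvg (cvg_of _ _ dX) (cvg_of _ _ dV).
  suff : \forall y \near s^', `[0, T]%classic y -> 0 <= id y <= T by [].
  by apply: nearW => y /=; rewrite in_itv.
have : (fun y => a y + b y * ((X y - X s) / (y - s)) + c y * ((V y - V s) / (y - s)))
    @ (within `[0, T] s^') -->
    ft s (X s) (V s) + fx s (X s) (V s) * X' + fv s (X s) (V s) * V'.
  by apply: cvgD; [apply: cvgD => //; exact: cvgM|exact: cvgM].
rewrite /has_derivative_within; apply: cvg_trans; apply: near_eq_cvg.
apply: filterS2 neq E => y ys /= ->.
by field.
Unshelve. all: by end_near. Qed.

End C1Strip.
End StripCalculus.

(** * Charge, current and field *)

Section FieldEquations.
Context {R : realType}.
Local Notation mu := (@lebesgue_measure R).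
Implicit Types (s t x y v T P : R).

(** Once Q_g is finite, F and f vanish for large momenta uniformly on the time
    interval; P bounds both supports.  The derivatives of f are named. *)
Record compact_momentum_solution T P (F : R -> R) (f : R -> R -> R -> R)
    (E : R -> R -> R) (ft fx fv : R -> R -> R -> R) : Prop := {
  cms_T : 0 < T;
  cms_P : 0 < P;
  cms_C1 : C1_strip_with T f ft fx fv;
  cms_vlasov : forall t x v, 0 <= t <= T ->
    ft t x v + v * fx t x v - E t x * fv t x v = 0;
  cms_F : continuous F;
  cms_suppF : forall v, P <= `|v| -> F v = 0;
  cms_suppf : forall t x v, 0 <= t <= T -> P <= `|v| -> f t x v = 0;
  cms_rho : forall t, 0 <= t <= T ->
    mu.-integrable [set: R] (fun y => (rho F f t y)%:E);
  cms_field : forall t x, 0 <= t <= T ->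
    E t x = 2^-1 * ((\int[mu]_(y in `]-oo, x]) rho F f t y)
                    - (\int[mu]_(y in `[x, +oo[) rho F f t y)) }.

Variables (T P : R) (F : R -> R) (f : R -> R -> R -> R) (E : R -> R -> R).
Variables (ft fx fv : R -> R -> R -> R).
Hypothesis S : compact_momentum_solution T P F f E ft fx fv.

Let T0 : 0 < T := cms_T S.
Let P0 : 0 < P := cms_P S.
Let T0' : 0 <= T := ltW T0.
Let NPP : - P <= P. Proof. by rewrite ge0_cp // ltW. Qed.
Let C1 := cms_C1 S.

Let cf := C1_strip_continuous T0' C1.
Let cft : continuous (fun p : R * R * R => ft (clamp T p.1.1) p.1.2 p.2).
Proof. by have [_ ? _ _] := C1; exact: continuous_on_strip. Qed.
Let cfx : continuous (fun p : R * R * R => fx (clamp T p.1.1) p.1.2 p.2).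
Proof. by have [_ _ ? _] := C1; exact: continuous_on_strip. Qed.
Let cfv : continuous (fun p : R * R * R => fv (clamp T p.1.1) p.1.2 p.2).
Proof. by have [_ _ _ ?] := C1; exact: continuous_on_strip. Qed.

Definition density s y := \int[mu]_(v in `[- P, P]) (F v - f (clamp T s) y v).
Definition current s y := \int[mu]_(v in `[- P, P]) (v * f (clamp T s) y v).

Lemma rho_density t x : 0 <= t <= T -> rho F f t x = density t x.
Proof.
move=> tT; rewrite /rho /density Rintegral_mkcond [RHS]Rintegral_mkcond.
apply: eq_Rintegral => v _; rewrite !patchE mem_set // clamp_id //; case: ifPn => // /negP vP.
have Pv : P <= `|v|.
  rewrite leNgt; apply/negP; rewrite ltr_norml => /andP[? ?]; apply: vP.
  by rewrite inE /= in_itv/=; apply/andP; split; exact: ltW.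
by rewrite /pert (cms_suppF S) // (cms_suppf S) // subrr.
Qed.

Lemma continuous_density : continuous (fun p : R * R => density p.1 p.2).
Proof.
apply: (@continuous_parameter_integral R (R * R)%type
  (fun p v => F v - f (clamp T p.1) p.2 v) _ _ NPP).
move=> p; apply: cvgB; last exact: cf.
by apply: (@cvg_comp _ _ _ snd F); [exact: cvg_snd_at|exact: (cms_F S)].
Qed.

Lemma continuous_density_at s : continuous (density s).
Proof. exact: (continuous_section continuous_density). Qed.

Lemma is_derive_clamp h s l : 0 < s < T ->
  has_derivative_within `[0, T] h s l ->
  is_derive s 1 (fun t => h (clamp T t)) l.
Proof.
move=> sT /(has_derivative_within_is_derive sT)/is_derive1P hl.
have sT' : 0 <= s <= T by move/andP: sT => [/ltW-> /ltW->].
apply/is_derive1P => e /hl[d d0 hd]; move/andP: sT => [s0 sT].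
exists (Num.min d (Num.min s (T - s))); first by rewrite !lt_min d0 s0 subr_gt0.
move=> y; rewrite !lt_min => /and3P[yd ya yb].
have yT : 0 <= y <= T.
  by move: ya yb; rewrite !ltr_norml => /andP[? ?] /andP[? ?]; apply/andP; split; lra.
by rewrite !clamp_id //; exact: hd.
Qed.

Let densityt s y := \int[mu]_(v in `[- P, P]) (- ft (clamp T s) y v).
Let currentx s y := \int[mu]_(v in `[- P, P]) (v * fx (clamp T s) y v).

Let fix_time (h : R * R * R -> R) s : continuous h ->
  continuous (fun p : R * R => h (s, p.1, p.2)).
Proof.
move=> ch p; apply: (@cvg_comp _ _ _ (fun p : R * R => (s, p.1, p.2)) h);
  last exact: ch.
apply: (@cvg_to_pair _ _ _ (nbhs p)); last exact: cvg_snd_at.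
by apply: (@cvg_to_pair _ _ _ (nbhs p)); [exact: cvg_cst|exact: cvg_fst_at].
Qed.

Let fix_space (h : R * R * R -> R) y : continuous h ->
  continuous (fun p : R * R => h (p.1, y, p.2)).
Proof.
move=> ch p; apply: (@cvg_comp _ _ _ (fun p : R * R => (p.1, y, p.2)) h);
  last exact: ch.
apply: (@cvg_to_pair _ _ _ (nbhs p)); last exact: cvg_snd_at.
by apply: (@cvg_to_pair _ _ _ (nbhs p)); [exact: cvg_fst_at|exact: cvg_cst].
Qed.

Let fix_time_space (h : R * R * R -> R) s y : continuous h ->
  continuous (fun v => h (s, y, v)).
Proof.
by move=> ch; exact: (@continuous_section R R (fun y v => h (s, y, v)) (@fix_time h s ch)).
Qed.

Let is_derive_density s y : 0 < s < T ->
  is_derive s 1 (fun t => density t y) (densityt s y).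
Proof.
apply: (@is_derive_parameter_integral R (fun t v => F v - f (clamp T t) y v)
  (fun t v => - ft (clamp T t) y v)) => //.
- move=> t v; apply: cvgB; first exact: (cms_F S).
  exact: (@fix_time_space _ t y cf).
- by move=> p; apply: cvgN; exact: (@fix_space _ y cft).
move=> t v tT.
rewrite -[- ft _ _ _]add0r; apply: is_deriveB.
have tT' : 0 <= t <= T by move/andP: tT => [/ltW-> /ltW->].
have [df _ _ _] := C1; have [dt _ _] := df t y v tT'.
by rewrite (clamp_id tT'); exact: (is_derive_clamp tT dt).
Qed.

Let is_derive_current s y :
  is_derive y 1 (current s) (currentx s y).
Proof.
apply: (@is_derive_parameter_integral R (fun y v => v * f (clamp T s) y v)
  (fun y v => v * fx (clamp T s) y v) _ _ (y - 1) (y + 1)) => //.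
- by move=> x v; apply: cvgM; [exact: cvg_id|exact: (@fix_time_space _ s x cf)].
- by move=> p; apply: cvgM; [exact: cvg_snd_at|exact: (@fix_time _ s cfx)].
- move=> x v _; have [df _ _ _] := C1.
  have [_ dx _] := df (clamp T s) x v (clamp_itv s T0').
  exact: (@is_deriveZ R R R (fun y => f (clamp T s) y v) v x 1 _ dx).
by rewrite ltrBlDr ltrDl ltr01.
Qed.

(** Charge conservation: integrating the Vlasov equation in v, the force term
    is a total derivative and vanishes by compact support. *)
Let continuity_equation s y : 0 <= s <= T -> densityt s y = currentx s y.
Proof.
move=> sT; rewrite /densityt /currentx.
have E1 : \int[mu]_(v in `[- P, P]) (E s y * fv (clamp T s) y v) = 0.
  rewrite RintegralZl //; last exact/continuous_integrable/(@fix_time_space _ s y cfv).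
  have dv v : is_derive v 1 (fun v => f (clamp T s) y v) (fv (clamp T s) y v).
    have [df _ _ _] := C1.
    by have [_ _ dv] := df (clamp T s) y v (clamp_itv s T0').
  rewrite (Rintegral_derive NPP (@fix_time_space _ s y cfv) dv).
  by rewrite !clamp_id // !(cms_suppf S) ?subrr ?mulr0 // ?normrN ler_norm.
rewrite -[RHS]subr0 -[X in _ - X]E1 -RintegralB //.
- apply: eq_Rintegral => v _; have := cms_vlasov S y v sT; rewrite clamp_id //.
  by move=> V; apply/eqP; rewrite -subr_eq0 -oppr_eq0 -V; apply/eqP; ring.
- apply: continuous_integrable => v; apply: cvgM; first exact: cvg_id.
  exact: (@fix_time_space _ s y cfx).
- apply: continuous_integrable => v; apply: cvgM; first exact: cvg_cst.
  exact: (@fix_time_space _ s y cfv).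
Qed.

Let continuous_densityt : continuous (fun p : R * R => densityt p.1 p.2).
Proof.
apply: (@continuous_parameter_integral R (R * R)%type
  (fun p v => - ft (clamp T p.1) p.2 v) _ _ NPP).
by move=> p; apply: cvgN; exact: cft.
Qed.

Let continuous_currentx s : continuous (currentx s).
Proof.
apply: (@continuous_parameter_integral R R
  (fun y v => v * fx (clamp T s) y v) _ _ NPP).
by move=> p; apply: cvgM; [exact: cvg_snd_at|exact: (@fix_time _ s cfx)].
Qed.

(** The charge between x and y changes only through the currents at the two
    ends: the time derivative of the density is the space derivative of the
    current. *)
Lemma is_derive_charge s x y : x <= y -> 0 < s < T ->
  is_derive s 1 (fun t => \int[mu]_(z in `[x, y]) density t z)
    (current s y - current s x).
Proof.
move=> xy sT; have sT' : 0 <= s <= T by move/andP: sT => [/ltW-> /ltW->].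
rewrite -(Rintegral_derive xy (@continuous_currentx s) (is_derive_current s)).
have -> : \int[mu]_(z in `[x, y]) currentx s z = \int[mu]_(z in `[x, y]) densityt s z.
  by apply: eq_Rintegral => z _; rewrite continuity_equation.
apply: (is_derive_parameter_integral xy _ continuous_densityt _ sT).
  exact: continuous_density_at.
by move=> t z tT; exact: is_derive_density.
Qed.

(** The two half-line integrals of the field formula differ in opposite ways, so
    the total charge drops out of increments of E. *)
Lemma field_increment t x y : 0 <= t <= T -> x <= y ->
  E t y - E t x = \int[mu]_(z in `[x, y]) density t z.
Proof.
move=> tT xy; rewrite !(cms_field S) //.
have ir (A : set R) : measurable A -> mu.-integrable A (EFin \o rho F f t).
  by move=> mA; apply: integrableS (cms_rho S tT).
have L : \int[mu]_(z in `]-oo, y]) rho F f t z -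
    \int[mu]_(z in `]-oo, x]) rho F f t z = \int[mu]_(z in `[x, y]) rho F f t z.
  by rewrite Rintegral_itvB ?bnd_simp // ?Rintegral_itv_obnd_cbnd //; exact: ir.
have U : \int[mu]_(z in `[x, +oo[) rho F f t z -
    \int[mu]_(z in `[x, y]) rho F f t z = \int[mu]_(z in `[y, +oo[) rho F f t z.
  by rewrite Rintegral_itvB ?bnd_simp // ?Rintegral_itv_obnd_cbnd //; exact: ir.
have -> : \int[mu]_(z in `[x, y]) density t z = \int[mu]_(z in `[x, y]) rho F f t z.
  by apply: eq_Rintegral => z _; rewrite rho_density.
rewrite -U.
by move/eqP: L; rewrite subr_eq => /eqP ->; field.
Qed.

End FieldEquations.

(** * Differentiability of the field, conservation along characteristics *)

Section FieldRegularity.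
Context {R : realType}.
Local Notation mu := (@lebesgue_measure R).
Implicit Types (s t x y v : R).

Variables (T P : R) (F : R -> R) (f : R -> R -> R -> R) (E : R -> R -> R).
Variables (ft fx fv : R -> R -> R -> R).
Hypothesis S : compact_momentum_solution T P F f E ft fx fv.

Let T0 : 0 < T := cms_T S.
Let P0 : 0 < P := cms_P S.
Let T0' : 0 <= T := ltW T0.
Let NPP : - P <= P. Proof. by rewrite ge0_cp // ltW. Qed.
Let C1 := cms_C1 S.
Local Notation dens := (density T P F f).
Local Notation curr := (current T P f).

Lemma is_derive_field t x : 0 <= t <= T -> is_derive x 1 (E t) (rho F f t x).
Proof.
move=> tT; rewrite (rho_density S) //; apply/is_derive1P => e e0.
have cd := @continuous_density_at _ _ _ _ _ _ _ _ _ S t.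
have /cvgrPdist_le/(_ e e0)[d /= d0 hd] := cd x.
exists d => // y yx.
have near_x z : `|z - x| <= `|y - x| -> `|dens t z - dens t x| <= e.
  by move=> zx; rewrite distrC; apply: hd; rewrite /ball_/= distrC (le_lt_trans zx).
have key a b : a <= b -> (forall z, a <= z <= b -> `|z - x| <= `|y - x|) ->
    `|E t b - E t a - dens t x * (b - a)| <= e * (b - a).
  move=> ab zx; rewrite (field_increment S tT ab).
  have -> : dens t x * (b - a) = \int[mu]_(z in `[a, b]) dens t x.
    rewrite Rintegral_cst //= lebesgue_measure_itv /= lte_fin.
    by move: ab; rewrite le_eqVlt => /predU1P[->|->] //; rewrite ltxx subrr.
  have ic : mu.-integrable `[a, b] (EFin \o cst (dens t x)).
    by apply: continuous_integrable; exact: cst_continuous.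
  rewrite -RintegralB //; last exact: continuous_integrable.
  apply: normr_Rintegral_le => //.
    apply: continuous_integrable => z; apply: cvgB; first exact: cd.
    exact: cvg_cst.
  by move=> z /zx; exact: near_x.
have [xy|/ltW yx'] := leP x y.
  rewrite (ger0_norm (x := y - x)) ?subr_ge0 //; apply: key => // z /andP[xz zy].
  by rewrite !ger0_norm ?subr_ge0 // lerB.
rewrite (ler0_norm (x := y - x)) ?subr_le0 // opprB.
have -> : E t y - E t x - dens t x * (y - x) =
    - (E t x - E t y - dens t x * (x - y)) by ring.
rewrite normrN.
apply: key => // z /andP[yz zx].
by rewrite !ler0_norm ?subr_le0 // lerN2 lerB.
Qed.

(** Increments of E in x are charges, so their evolution is controlled by the
    difference of the currents.  Comparing two points rather than one point with
    infinity avoids any knowledge of the total charge. *)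
Lemma field_increment_time t x y M : 0 <= t <= T ->
  (forall s, 0 <= s <= t -> `|curr s y - curr s x| <= M) ->
  `|E t y - E t x - (E 0 y - E 0 x)| <= M * t.
Proof.
wlog xy : x y / x <= y => [W|tT hM].
  move=> tT hM; have [xy|/ltW yx] := leP x y; first exact: W.
  have -> : E t y - E t x - (E 0 y - E 0 x) = - (E t x - E t y - (E 0 x - E 0 y)).
    by ring.
  rewrite normrN.
  by apply: W => // s sT; rewrite distrC; exact: hM.
have /andP[t0 tT'] := tT.
rewrite !(field_increment S) // ?lexx //.
have [||c] := @MVT_segment R (fun s => \int[mu]_(z in `[x, y]) dens s z)
    (fun s => curr s y - curr s x) 0 t t0.
- move=> s; rewrite in_itv/= => /andP[s0 st].
  by apply: (is_derive_charge S) => //; rewrite s0 (lt_le_trans st).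
- apply: continuous_subspaceT.
  exact: (continuous_parameter_integral xy (continuous_density S)).
rewrite in_itv/= => ct ->; rewrite subr0 normrM [`|t|]ger0_norm //.
by rewrite ler_wpM2r // hM.
Qed.

Lemma current_increment s x y M : 0 <= s <= T -> 0 <= M ->
  (forall v, `|f s x v - f s y v| <= M) ->
  `|curr s x - curr s y| <= P * M * (P + P).
Proof.
move=> sT M0 hM.
have cv z : continuous (fun v => v * f (clamp T s) z v).
  move=> v; apply: cvgM; first exact: cvg_id.
  have [df _ _ _] := C1; have [_ _ dv] := df (clamp T s) z v (clamp_itv s T0').
  by apply: differentiable_continuous; apply/derivable1_diffP; exact: ex_derive.
rewrite /current -RintegralB //; [|exact: continuous_integrable..].
rewrite -[X in P + X]opprK; apply: normr_Rintegral_le => //.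
  by apply: continuous_integrable => v; apply: cvgB; exact: cv.
move=> v vP; rewrite clamp_id // -mulrBr normrM.
by apply: ler_pM => //; rewrite ler_norml.
Qed.

Lemma constant_along_characteristics (X V : R -> R -> R -> R -> R) :
  characteristics T E X V -> forall t x v s, 0 <= t <= T -> 0 <= s <= T ->
  f s (X s t x v) (V s t x v) = f t x v.
Proof.
move=> ch t x v s tT sT; have [Xt Vt dXV] := ch t x v tT.
have [|c [cT _ H]] := @mean_value_within_near R 0 T t s
    (fun y => f y (X y t x v) (V y t x v)) (fun=> 0) _ tT sT.
  move=> y yT; have [dX dV] := dXV y yT.
  have := strip_chain_rule T0' C1 yT dX dV.
  rewrite (_ : _ + _ = 0) // -[RHS](cms_vlasov S (X y t x v) (V y t x v) yT).
  by ring.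
by move: H; rewrite mul0r Xt Vt => /eqP; rewrite subr_eq0 => /eqP.
Qed.

End FieldRegularity.

(** * Continuity of the field in time *)

Section FieldContinuity.
Context {R : realType}.
Local Notation mu := (@lebesgue_measure R).
Implicit Types (s t x y v : R).

Lemma clamp_clamp T s : 0 <= T -> clamp T (clamp T s) = clamp T s.
Proof. by move=> T0; rewrite (clamp_id (clamp_itv s T0)). Qed.

Lemma continuous_within_clamp T (h : R -> R) : 0 <= T ->
  {within `[0, T], continuous h} -> continuous (fun s => h (clamp T s)).
Proof.
move=> T0 /subspace_continuousP ch s.
have cT : `[0, T]%classic (clamp T s) by rewrite /= in_itv/=; exact: clamp_itv.
move=> U /(ch _ cT)/(@continuous_clamp _ T s) H.
have H2 : \forall q \near s, `[0, T]%classic (clamp T q) -> U (h (clamp T q)).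
  exact: H.
by apply: (filterS _ H2) => q; apply; rewrite /= in_itv/=; exact: clamp_itv.
Qed.

Variables (T P : R) (F : R -> R) (f : R -> R -> R -> R) (E : R -> R -> R).
Variables (ft fx fv : R -> R -> R -> R).
Hypothesis S : compact_momentum_solution T P F f E ft fx fv.
Variables (X V : R -> R -> R -> R -> R).
Hypothesis ch : characteristics T E X V.

Let T0 : 0 < T := cms_T S.
Let P0 : 0 < P := cms_P S.
Let T0' : 0 <= T := ltW T0.
Let C1 := cms_C1 S.
Local Notation dens := (density T P F f).

Let continuous_field_increment x y :
  continuous (fun s => E (clamp T s) y - E (clamp T s) x).
Proof.
wlog xy : x y / x <= y => [W|].
  have [xy|/ltW yx] := leP x y; first exact: W.
  rewrite (_ : (fun s => _) = (fun s => - (E (clamp T s) x - E (clamp T s) y))).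
    by move=> s; apply: cvgN; exact: W.
  by apply/funext => s; rewrite opprB.
move=> s.
have -> : (fun s => E (clamp T s) y - E (clamp T s) x) =
    (fun s => \int[mu]_(z in `[x, y]) dens s z).
  apply/funext => z; rewrite (field_increment S (clamp_itv z T0') xy).
  by apply: eq_Rintegral => w _; rewrite /density clamp_clamp.
exact: (continuous_parameter_integral xy (continuous_density S)).
Qed.

(** Where the v-derivative of f does not vanish, the Vlasov equation itself
    expresses E as a quotient of continuous functions. *)
Let continuous_field_at s x0 v0 : fv (clamp T s) x0 v0 != 0 ->
  (fun t => E (clamp T t) x0) @ s --> E (clamp T s) x0.
Proof.
move=> fv0; have [_ cft cfx cfv] := C1.
have cvg_t (g : R -> R -> R -> R) :
    {within time_strip T, continuous (fun p : R * R * R => g p.1.1 p.1.2 p.2)} ->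
    (fun t => g (clamp T t) x0 v0) @ s --> g (clamp T s) x0 v0.
  move=> /(continuous_on_strip T0')/(_ (s, x0, v0)) cg.
  apply: (@cvg_comp _ _ _ (fun t => (t, x0, v0)) _ _ _ _ _ cg).
  apply: (@cvg_to_pair _ _ _ (nbhs s)); last exact: cvg_cst.
  by apply: (@cvg_to_pair _ _ _ (nbhs s)); [exact: cvg_id|exact: cvg_cst].
have Eq t : fv (clamp T t) x0 v0 != 0 -> E (clamp T t) x0 =
    (ft (clamp T t) x0 v0 + v0 * fx (clamp T t) x0 v0) * (fv (clamp T t) x0 v0)^-1.
  move=> n0; have := cms_vlasov S x0 v0 (clamp_itv t T0').
  by move/eqP; rewrite subr_eq0 => /eqP ->; rewrite mulfK.
rewrite (Eq _ fv0).
have : (fun t => (ft (clamp T t) x0 v0 + v0 * fx (clamp T t) x0 v0)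
     * (fv (clamp T t) x0 v0)^-1) @ s -->
   (ft (clamp T s) x0 v0 + v0 * fx (clamp T s) x0 v0) * (fv (clamp T s) x0 v0)^-1.
  apply: cvgM; last by apply: cvgV => //; exact: cvg_t.
  by apply: cvgD; [exact: cvg_t|apply: cvgM; [exact: cvg_cst|exact: cvg_t]].
apply: cvg_trans; apply: near_eq_cvg.
have : \forall t \near s, fv (clamp T t) x0 v0 != 0.
  have := cvg_t _ cfv => /cvgr_neq0; exact.
by apply: filterS => t n0; rewrite [RHS]Eq.
Qed.

(** Spatial increments of E are integrals of the density, hence continuous, so
    one point of continuity of E(., x0) at a given time is enough. *)
Let continuous_field_of_point t x0 x :
  (fun s => E (clamp T s) x0) @ t --> E (clamp T t) x0 ->
  (fun p : R * R => E (clamp T p.1) p.2) @ (t, x) --> E (clamp T t) x.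
Proof.
move=> c0; have c0p := cvg_comp fst _ (@cvg_fst_at _ _ (t, x)) c0.
have c1p := cvg_comp fst _ (@cvg_fst_at _ _ (t, x)) (@continuous_field_increment x0 x t).
have /choice[xi Hxi] : forall p : R * R, exists z, `|z - x| <= `|p.2 - x| /\
    E (clamp T p.1) p.2 - E (clamp T p.1) x = dens p.1 z * (p.2 - x).
  move=> p; have dE y := is_derive_field S y (clamp_itv p.1 T0').
  have [z [zx Ez]] := mean_value_near x p.2 dE.
  exists z; split => //; rewrite Ez (rho_density S) ?clamp_itv //.
  by rewrite /density clamp_clamp.
have xi_cvg : xi @ (t, x) --> x.
  apply: (@cvg_closer _ _ _ snd); first exact: cvg_snd_at.
  by apply: nearW => p; have [] := Hxi p.
have dens_cvg : (fun p => dens p.1 (xi p)) @ (t, x) --> dens t x.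
  have cd := @continuous_density _ _ _ _ _ _ _ _ _ S (t, x).
  apply: (@cvg_comp _ _ _ (fun p => (p.1, xi p)) (fun p => dens p.1 p.2) _ _ _ _ cd).
  apply: (@cvg_to_pair _ _ _ (nbhs (t, x))) => //.
  exact: cvg_fst_at.
have c2p : (fun p => dens p.1 (xi p) * (p.2 - x)) @ (t, x) --> dens t x * (x - x).
  by apply: cvgM => //; apply: cvgB; [exact: cvg_snd_at|exact: cvg_cst].
have : (fun p : R * R => E (clamp T p.1) x0 + (E (clamp T p.1) x - E (clamp T p.1) x0)
    + dens p.1 (xi p) * (p.2 - x)) @ (t, x) -->
    E (clamp T t) x0 + (E (clamp T t) x - E (clamp T t) x0) + dens t x * (x - x).
  by apply: cvgD => //; apply: cvgD.
rewrite subrr mulr0 addr0 addrC subrK; apply: cvg_trans.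
apply: near_eq_cvg; apply: nearW => p /=; have [_ <-] := Hxi p; ring.
Qed.

Variable r : R.
Hypothesis out0 : forall x v, r < `|x| -> f 0 x v = F v.

(** Continuity of E in t is not part of the definition of a solution.  If f is
    not identically zero at time t then, by compact support in v, its
    v-derivative is nonzero somewhere, and the two preceding lemmas apply.  If f
    is identically zero at one time it is so always, being constant along
    characteristics; then F = 0 by the initial condition at large x, and E = 0. *)
Lemma continuous_field : continuous (fun p : R * R => E (clamp T p.1) p.2).
Proof.
have [[t0 [t0T vac]]|nvac] :=
    pselect (exists t0, 0 <= t0 <= T /\ forall x v, f t0 x v = 0).
  have f0 t x v : 0 <= t <= T -> f t x v = 0.
    move=> tT; rewrite -(constant_along_characteristics S ch x v tT t0T).
    exact: vac.
  have F0 v : F v = 0.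
    rewrite -(@out0 (`|r| + 1)) ?f0 ?lexx //.
    by rewrite ger0_norm ?addr_ge0 // ltr_pwDr // ler_norm.
  have rho0 t y : 0 <= t <= T -> rho F f t y = 0.
    move=> tT; rewrite /rho (_ : pert F f t y = cst 0).
      by rewrite /Rintegral integral0.
    by apply/funext => v; rewrite /pert F0 f0 // subrr.
  have E0 t x : 0 <= t <= T -> E t x = 0.
    move=> tT; rewrite (cms_field S) //.
    rewrite (_ : (fun y => rho F f t y) = cst 0).
      by rewrite /Rintegral !integral0 subrr mulr0.
    by apply/funext => y; rewrite rho0.
  move=> p; rewrite (_ : (fun p : R * R => _) = cst 0); first exact: cvg_cst.
  by apply/funext => q; rewrite E0 // clamp_itv.
move=> [t x].
have tT := clamp_itv t T0'.
have [x0 [v0 fv0]] : exists x0 v0, fv (clamp T t) x0 v0 != 0.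
  apply: contrapT => H; apply: nvac; exists (clamp T t); split => // y v.
  have [df _ _ _] := C1.
  have dv (w : R) : is_derive w 1 (fun w => f (clamp T t) y w) (fv (clamp T t) y w).
    by have [] := df (clamp T t) y w tT.
  have [z [_ Ez]] := mean_value_near P v dv.
  have fz : fv (clamp T t) y z = 0.
    by apply/eqP; apply: contrapT => /negP ?; apply: H; exists y, z.
  by move: Ez; rewrite fz mul0r /= (cms_suppf S y tT (ler_norm P)) subr0.
exact: (continuous_field_of_point (continuous_field_at fv0)).
Qed.

End FieldContinuity.

(** * Displacement along characteristics *)

Section Displacement.
Context {R : realType}.
Local Notation mu := (@lebesgue_measure R).
Implicit Types (s t x y v : R).

Variables (T P : R) (F : R -> R) (f : R -> R -> R -> R) (E : R -> R -> R).
Variables (ft fx fv : R -> R -> R -> R).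
Hypothesis S : compact_momentum_solution T P F f E ft fx fv.
Variables (X V : R -> R -> R -> R -> R).
Hypothesis ch : characteristics T E X V.
Variable r : R.
Hypothesis out0 : forall x v, r < `|x| -> f 0 x v = F v.
Hypothesis intE : mu.-integrable `[0, T] (fun tau => supnorm (E tau)).

Let T0 : 0 < T := cms_T S.
Let T0' : 0 <= T := ltW T0.

Lemma le_supnorm (h : R -> R) x : (`|h x|%:E <= supnorm h)%E.
Proof. by apply: ereal_sup_ubound; exists x. Qed.

Lemma supnorm_ge0 (h : R -> R) : (0 <= supnorm h)%E.
Proof. by apply: le_trans (le_supnorm h 0); rewrite lee_fin. Qed.

Let intE_sub a b : 0 <= a -> b <= T ->
  mu.-integrable `[a, b] (fun tau => supnorm (E tau)).
Proof.
move=> a0 bT; apply: integrableS intE => //.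
move=> y /=; rewrite !in_itv/= => /andP[ay yb].
by rewrite (le_trans a0) // (le_trans yb).
Qed.

(** A bound for the change of momentum between s and T.  The clamp makes it
    nonincreasing on the whole line, from which its measurability follows. *)
Definition impulse s : R :=
  fine (\int[mu]_(tau in `[clamp T s, T]) supnorm (E tau))%E.

Lemma impulse_fin s : 0 <= s <= T ->
  ((impulse s)%:E = \int[mu]_(tau in `[s, T]) supnorm (E tau))%E.
Proof.
move=> /[dup] sT /andP[s0 _]; rewrite /impulse clamp_id // fineK //.
by apply: integrable_fin_num => //; exact: intE_sub.
Qed.

Lemma impulse_ge0 s : 0 <= impulse s.
Proof. by apply/fine_ge0/integral_ge0 => y _; exact: supnorm_ge0. Qed.

Lemma le_impulse s t : s <= t -> impulse t <= impulse s.
Proof.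
move=> st; apply: fine_le.
- by apply: integrable_fin_num => //; apply: intE_sub => //; case/andP: (clamp_itv t T0').
- by apply: integrable_fin_num => //; apply: intE_sub => //; case/andP: (clamp_itv s T0').
apply: ge0_subset_integral => //.
- by apply: (measurable_int mu); apply: intE_sub => //; case/andP: (clamp_itv s T0').
- by move=> y _; exact: supnorm_ge0.
move=> y /=; rewrite !in_itv/= => /andP[ty ->]; rewrite andbT.
apply: le_trans ty; rewrite /clamp ge_max !le_max lexx /=.
by rewrite le_min !ge_min st lexx !orbT.
Qed.

Lemma impulse_integrable a b : mu.-integrable `[a, b] (EFin \o impulse).
Proof.
apply: measurable_bounded_integrable => //=.
- by rewrite lebesgue_measure_itv /=; case: ifP => // _; rewrite -EFinD ltry.
- by apply: measurable_realfun.nonincreasing_measurable => // s t; exact: le_impulse.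
exists (impulse 0); split; first by rewrite num_real.
move=> M M0 y _ /=; rewrite ger0_norm ?impulse_ge0 // (le_trans _ (ltW M0)) //.
apply: (@le_trans _ _ (impulse (clamp T y))).
  by rewrite /impulse clamp_clamp.
by apply: le_impulse; case/andP: (clamp_itv y T0').
Qed.

(** Continuity of the field along the trajectory is what allows V to be
    recovered by integrating its derivative. *)
Lemma momentum_displacement t x v s : 0 <= t <= T -> 0 <= s <= t ->
  `|V s t x v - v| <= impulse s.
Proof.
move=> /[dup] tT /andP[t0 tT'] /andP[s0 st].
have [Xt Vt dXV] := ch x v tT.
have cX : {within `[0, T], continuous (fun s => X s t x v)}.
  by apply: (has_derivative_within_continuous (h' := fun s => V s t x v)) => y /dXV[].
have cV : {within `[0, T], continuous (fun s => V s t x v)}.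
  by apply: (has_derivative_within_continuous (h' := fun s => - E s (X s t x v)))
    => y /dXV[].
pose a y := - E (clamp T y) (X (clamp T y) t x v).
have ca : continuous a.
  move=> y; apply: cvgN.
  have cE := @continuous_field _ _ _ _ _ _ _ _ _ S _ _ ch _ out0
    (y, X (clamp T y) t x v).
  apply: (@cvg_comp _ _ _ (fun y => (y, X (clamp T y) t x v))
    (fun p => E (clamp T p.1) p.2) _ _ _ _ cE).
  apply: (@cvg_to_pair _ _ _ (nbhs y)); first exact: cvg_id.
  exact: (continuous_within_clamp T0' cX).
have Ia : \int[mu]_(y in `[s, t]) a y = v - V s t x v.
  rewrite -[X in X - _]Vt.
  apply: (@Rintegral_within_derive R s t (fun y => V y t x v) a st).
  - apply: continuous_subspaceW cV => y /=; rewrite !in_itv/= => /andP[sy yt].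
    by rewrite (le_trans s0) // (le_trans yt).
  - exact: continuous_subspaceT.
  move=> y /andP[sy yt].
  have yT : 0 < y < T by rewrite (le_lt_trans s0) // (lt_le_trans yt).
  have yT' : 0 <= y <= T by move/andP: yT => [/ltW-> /ltW->].
  apply: (has_derivative_within_is_derive yT).
  by rewrite /a clamp_id //; have [] := dXV y yT'.
have ia : mu.-integrable `[s, t] (EFin \o a) by exact: continuous_integrable.
rewrite distrC -Ia -lee_fin impulse_fin; last by rewrite s0 (le_trans st).
apply: (@le_trans _ _ (\int[mu]_(y in `[s, t]) supnorm (E y))%E); last first.
  apply: ge0_subset_integral => //.
  - by apply: (measurable_int mu); exact: intE_sub.
  - by move=> y _; exact: supnorm_ge0.
  by move=> y /=; rewrite !in_itv/= => /andP[-> /le_trans->].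
rewrite EFin_normr_Rintegral //.
apply: (le_trans (le_abse_integral _ _ _)) => //.
  by case/integrableP : ia.
apply: ge0_le_integral => //.
- exact: (measurable_int mu (integrable_abse ia)).
- by apply: (measurable_int mu); exact: intE_sub.
move=> y /=; rewrite in_itv/= => /andP[sy yt].
have yT' : 0 <= y <= T by rewrite (le_trans s0) // (le_trans yt).
by rewrite /a clamp_id // normrN; exact: le_supnorm.
Qed.

(** With q = Q_g(T), reach q T is R(T).  At earlier times s the field is
    integrated up to T, not only up to s: this makes increments of reach bound
    displacements for every final time at once. *)
Definition reach q s : R := r + s * q + \int[mu]_(tau in `[0, s]) impulse tau.

Lemma reachB q s t : 0 <= s -> s <= t ->
  reach q t - reach q s = \int[mu]_(tau in `[s, t]) (q + impulse tau).
Proof.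
move=> s0 st.
have i0 a b : mu.-integrable `[a, b] (EFin \o cst q).
  by apply: continuous_integrable; exact: cst_continuous.
rewrite RintegralD //; last exact: impulse_integrable.
have E1 : \int[mu]_(tau in `[0, t]) impulse tau - \int[mu]_(tau in `[0, s]) impulse tau =
    \int[mu]_(tau in `[s, t]) impulse tau.
  rewrite Rintegral_itvB ?bnd_simp //; last exact: impulse_integrable.
  rewrite Rintegral_itv_obnd_cbnd //.
  by apply: (integrableS _ _ _ (impulse_integrable s t)) => //; exact: subset_itv_oc_cc.
have E2 : \int[mu]_(tau in `[s, t]) q = q * (t - s).
  rewrite Rintegral_cst //= lebesgue_measure_itv /= lte_fin.
  by move: st; rewrite le_eqVlt => /predU1P[->|->] //; rewrite ltxx subrr.
by rewrite E2 -E1 /reach; ring.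
Qed.

Lemma reach0 q : reach q 0 = r.
Proof. by rewrite /reach mul0r addr0 set_itv1 Rintegral_set1 addr0. Qed.

Lemma le_reach q s t : 0 <= q -> 0 <= s -> s <= t -> reach q s <= reach q t.
Proof.
move=> q0 s0 st; rewrite -subr_ge0 reachB //; apply: Rintegral_ge0 => y _.
by rewrite addr_ge0 // impulse_ge0.
Qed.

Lemma space_displacement q t x v s : 0 <= t <= T -> 0 <= s <= t -> `|v| <= q ->
  `|X s t x v - x| <= reach q t - reach q s.
Proof.
move=> /[dup] tT /andP[t0 tT'] /andP[s0 st] vq.
have [Xt Vt dXV] := ch x v tT.
have cX : {within `[0, T], continuous (fun s => X s t x v)}.
  by apply: (has_derivative_within_continuous (h' := fun s => V s t x v)) => y /dXV[].
have cV : {within `[0, T], continuous (fun s => V s t x v)}.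
  by apply: (has_derivative_within_continuous (h' := fun s => - E s (X s t x v)))
    => y /dXV[].
have sub : `[s, t] `<=` `[0, T].
  move=> y /=; rewrite !in_itv/= => /andP[sy yt].
  by rewrite (le_trans s0) // (le_trans yt).
have cVst : {within `[s, t], continuous (fun s => V s t x v)}.
  exact: continuous_subspaceW cV.
have IV : \int[mu]_(y in `[s, t]) V y t x v = x - X s t x v.
  rewrite -[X in X - _]Xt.
  apply: (@Rintegral_within_derive R s t (fun y => X y t x v)
    (fun y => V y t x v) st) => //; first exact: continuous_subspaceW cX.
  move=> y /andP[sy yt].
  have yT : 0 < y < T by rewrite (le_lt_trans s0) // (lt_le_trans yt).
  have yT' : 0 <= y <= T by move/andP: yT => [/ltW-> /ltW->].
  by apply: (has_derivative_within_is_derive yT); have [] := dXV y yT'.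
have iV := continuous_itv_integrable cVst.
rewrite distrC -IV reachB //.
apply: (le_trans (le_normr_Rintegral _ iV)) => //.
apply: le_Rintegral => //.
- by have /integrable_abse := iV; exact: eq_integrable.
- have iq : mu.-integrable `[s, t] (EFin \o cst q).
    by apply: continuous_integrable; exact: cst_continuous.
  have := integrableD _ iq (impulse_integrable s t) => /(_ (measurable_itv _)).
  exact: eq_integrable.
move=> y /=; rewrite in_itv/= => /andP[sy yt].
have := momentum_displacement x v tT (s := y); rewrite (le_trans s0) // yt => /(_ isT) D.
rewrite -[V y t x v](subrK v) addrC (le_trans (ler_normD _ _)) //.
by rewrite lerD.
Qed.

End Displacement.

(** * The bootstrap in the outer region *)

Section OuterRegion.
Context {R : realType}.
Local Notation mu := (@lebesgue_measure R).
Implicit Types (s t x y v w : R).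

Lemma is_derive_exp_scale (k l s : R) :
  is_derive s 1 (fun y => k * expR (l * y)) (k * l * expR (l * s)).
Proof.
have d1 : is_derive s 1 (fun y : R => l * y) l.
  have := @is_deriveZ R R R id l s 1 1 (is_derive_id _ _).
  by move=> H; apply: (is_derive_eq H); rewrite /GRing.scale/= mulr1.
have d2 := @is_derive1_comp R expR (fun y : R => l * y) s _ _ (is_derive_expR _) d1.
have d3 := @is_deriveZ R R R (expR \o (fun y => l * y)) k s 1 _ d2.
by apply: (is_derive_eq d3); rewrite /GRing.scale /=; ring.
Qed.

(** The exponential weight gains a factor 1 / l at each integration in time,
    which is what makes the bootstrap below contract. *)
Lemma exp_derivative_bound T t (h h' : R -> R) (k l : R) :
  (forall s, 0 <= s <= T -> has_derivative_within `[0, T] h s (h' s)) ->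
  0 <= t <= T -> 0 <= k -> 0 < l ->
  (forall s, 0 <= s <= t -> `|h' s| <= k * expR (l * s)) ->
  `|h t - h 0| <= k / l * expR (l * t).
Proof.
move=> dh /andP[t0 tT] k0 l0 hk.
have kl0 : 0 <= k / l by rewrite divr_ge0 // ltW.
have dexp (e : R) s :
    has_derivative_within `[0, T] (fun y => e * expR (l * y)) s (e * l * expR (l * s)).
  by apply: is_derive_has_derivative_within; exact: is_derive_exp_scale.
have le1 : k / l * expR (l * 0) >= 0 by rewrite mulr_ge0 // expR_ge0.
have kE : k / l * l = k by rewrite mulfVK // gt_eqF.
rewrite ler_norml; apply/andP; split.
- have dg s : 0 <= s <= T -> has_derivative_within `[0, T]
      (fun y => h y - (- (k / l)) * expR (l * y)) s (h' s - - (k / l) * l * expR (l * s)).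
    by move=> sT; apply: has_derivative_withinB; [exact: dh|exact: dexp].
  have [c ct Ec] := mean_value_within dg (lexx 0) t0 tT.
  have : 0 <= h t - - (k / l) * expR (l * t) - (h 0 - - (k / l) * expR (l * 0)).
    rewrite Ec mulr_ge0 ?subr_ge0 // !mulNr kE.
    by move: (hk c ct); rewrite ler_norml => /andP[].
  by move: le1; lra.
have dg s : 0 <= s <= T -> has_derivative_within `[0, T]
    (fun y => h y - k / l * expR (l * y)) s (h' s - k / l * l * expR (l * s)).
  by move=> sT; apply: has_derivative_withinB; [exact: dh|exact: dexp].
have [c ct Ec] := mean_value_within dg (lexx 0) t0 tT.
have : h t - k / l * expR (l * t) - (h 0 - k / l * expR (l * 0)) <= 0.
  rewrite Ec mulr_le0_ge0 ?subr_ge0 // kE subr_le0.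
  by move: (hk c ct); rewrite ler_norml => /andP[].
by move: le1; lra.
Qed.

Variables (T P : R) (F : R -> R) (f : R -> R -> R -> R) (E : R -> R -> R).
Variables (ft fx fv : R -> R -> R -> R).
Hypothesis S : compact_momentum_solution T P F f E ft fx fv.
Variables (X V : R -> R -> R -> R -> R).
Hypothesis ch : characteristics T E X V.
Variable r : R.
Hypothesis out0 : forall x v, r < `|x| -> f 0 x v = F v.
Hypothesis intE : mu.-integrable `[0, T] (fun tau => supnorm (E tau)).
Variables (q L B : R).
Hypothesis q0 : 0 <= q.
Hypothesis suppq : forall t x v, 0 <= t <= T -> q < `|v| -> f t x v = F v.
Hypothesis L0 : 0 <= L.
Hypothesis lipF : forall u v, `|F u - F v| <= L * `|u - v|.
Hypothesis bndF : forall v, `|F v| <= B.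

(** The sign ep selects one of the two components of the outer region, so that
    both are treated at once. *)
Variable ep : R.
Hypothesis ep1 : `|ep| = 1.

Let T0 : 0 < T := cms_T S.
Let P0 : 0 < P := cms_P S.
Let T0' : 0 <= T := ltW T0.
Let C1 := cms_C1 S.
Local Notation rch := (reach T E r q).

(** Characteristics with momentum at most q at time t, followed backwards from
    an outer point, stay outer and start where |x| > r. *)
Definition outer t x := rch t < ep * x.

Let outer_le s t x : 0 <= s -> s <= t -> outer t x -> outer s x.
Proof. by move=> s0 st; apply: le_lt_trans; exact: (le_reach S r intE q0 s0 st). Qed.

Let outer_between t x y z : outer t x -> outer t y -> x <= z <= y -> outer t z.
Proof.
rewrite /outer => ox oy /andP[xz zy]; have [e0|e0] := leP 0 ep.
  by rewrite (lt_le_trans ox) // ler_wpM2l.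
by apply: (lt_le_trans oy); exact: (ler_wnM2l (ltW e0) zy).
Qed.

Let outer_near t x y : outer t x -> `|y - x| < ep * x - rch t -> outer t y.
Proof.
rewrite /outer => ox yx.
have : ep * x - ep * y <= `|y - x|.
  by rewrite -mulrBr (le_trans (ler_norm _)) // normrM ep1 mul1r distrC.
by move: yx; lra.
Qed.

Let outer_characteristic s t x v : 0 <= t <= T -> 0 <= s <= t -> `|v| <= q ->
  outer t x -> outer s (X s t x v).
Proof.
move=> tT st vq; rewrite /outer => ox.
have D : `|X s t x v - x| <= rch t - rch s.
  exact: (space_displacement S ch out0 intE _ tT st vq).
have : ep * x - ep * X s t x v <= `|X s t x v - x|.
  by rewrite -mulrBr (le_trans (ler_norm _)) // normrM ep1 mul1r distrC.
by move: D; lra.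
Qed.

Let outer0 x : outer 0 x -> r < `|x|.
Proof.
rewrite /outer reach0 => /lt_le_trans; apply.
by rewrite (le_trans (ler_norm _)) // normrM ep1 mul1r.
Qed.

Let f_outer t x v : 0 <= t <= T -> outer t x -> `|v| <= q ->
  f t x v = F (V 0 t x v).
Proof.
move=> tT ox vq; have Tt : 0 <= (0 : R) <= T by rewrite lexx.
rewrite -(constant_along_characteristics S ch x v tT Tt) out0 //.
by apply/outer0/(outer_characteristic tT) => //; rewrite lexx; case/andP: tT.
Qed.

Let field_outer0 x y : outer 0 x -> outer 0 y -> E 0 x = E 0 y.
Proof.
wlog xy : x y / x <= y => [W ox oy|ox oy].
  by have [xy|/ltW yx] := leP x y; [exact: W|apply/esym; exact: W].
have Tt : 0 <= (0 : R) <= T by rewrite lexx.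
apply/esym/eqP; rewrite -subr_eq0 (field_increment S Tt xy).
rewrite (@eq_Rintegral _ _ _ _ _ (cst 0)) ?Rintegral_cst ?mul0r //.
move=> z; rewrite inE /= in_itv/= => /(outer_between ox oy)/outer0 rz.
rewrite -(rho_density S z Tt) /rho (_ : pert F f 0 z = cst 0).
  by rewrite /Rintegral integral0.
by apply/funext => v; rewrite /pert out0 // subrr.
Qed.

Let K := P * (P + P) * T.
Let K0 : 0 <= K. Proof. by rewrite !mulr_ge0 ?addr_ge0 // ltW. Qed.
Let l := 2 * (L * K) + 1.
Let l0 : 0 < l. Proof. by rewrite ltr_wpDl // mulr_ge0 // mulr_ge0. Qed.

(** A bounds the oscillation of f in x over the outer region, in the norm
    weighted by exp(- l s). *)
Definition spread A := forall s x y v, 0 <= s <= T -> outer s x -> outer s y ->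
  `|f s x v - f s y v| <= A * expR (l * s).

Let field_spread A t x y : 0 <= A -> spread A -> 0 <= t <= T ->
  outer t x -> outer t y -> `|E t x - E t y| <= K * A * expR (l * t).
Proof.
move=> A0 HA tT ox oy; have /andP[t0 tT'] := tT.
have ox0 := outer_le (lexx 0) t0 ox; have oy0 := outer_le (lexx 0) t0 oy.
have -> : E t x - E t y = E t x - E t y - (E 0 x - E 0 y).
  by rewrite (field_outer0 ox0 oy0) subrr subr0.
have Ae : 0 <= A * expR (l * t) by rewrite mulr_ge0 // expR_ge0.
apply: (@le_trans _ _ (P * (A * expR (l * t)) * (P + P) * t)).
  apply: (field_increment_time S tT) => s /andP[s0 st].
  have sT : 0 <= s <= T by rewrite s0 (le_trans st).
  apply: (current_increment S sT Ae) => v.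
  have ox' := outer_le s0 st ox; have oy' := outer_le s0 st oy.
  apply: (le_trans (HA s x y v sT ox' oy')).
  by rewrite ler_wpM2l // ler_expR ler_wpM2l // ltW.
rewrite [leRHS](_ : _ = P * (A * expR (l * t)) * (P + P) * T); last by rewrite /K; ring.
by rewrite ler_wpM2l // !mulr_ge0 ?addr_ge0 // ltW.
Qed.

Let momentum_spread A t x y v : 0 <= A -> spread A -> 0 <= t <= T ->
  `|v| <= q -> outer t x -> outer t y ->
  `|V 0 t x v - V 0 t y v| <= K * A / l * expR (l * t).
Proof.
move=> A0 HA tT vq ox oy.
have [_ Vx dx] := ch x v tT; have [_ Vy dy] := ch y v tT.
have dD s : 0 <= s <= T -> has_derivative_within `[0, T]
    (fun s => V s t x v - V s t y v) s (- E s (X s t x v) - - E s (X s t y v)).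
  by move=> sT; apply: has_derivative_withinB; [have [] := dx s sT|have [] := dy s sT].
have := exp_derivative_bound dD tT (mulr_ge0 K0 A0) l0.
rewrite Vx Vy subrr sub0r normrN; apply=> s st.
have sT : 0 <= s <= T by case/andP: st tT => -> ? /andP[_]; exact: le_trans.
rewrite opprK addrC distrC -opprB normrN distrC.
by rewrite field_spread //; exact: outer_characteristic.
Qed.

(** One turn of the loop: a spread of f gives a spread of the currents, hence of
    E, hence of the backward momenta, hence of f = F o V.  The weight l is large
    enough to beat the constants of this loop. *)
Let spread_half A : 0 <= A -> spread A -> spread (A / 2).
Proof.
move=> A0 HA t x y v tT ox oy; have [vq|qv] := leP `|v| q; last first.
  by rewrite !suppq // subrr normr0 mulr_ge0 ?expR_ge0 ?divr_ge0.
rewrite !f_outer // (le_trans (lipF _ _)) //.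
apply: (@le_trans _ _ (L * (K * A / l * expR (l * t)))).
  by rewrite ler_wpM2l // momentum_spread.
rewrite mulrA ler_wpM2r ?expR_ge0 // mulrA ler_pdivrMr // [L * (K * A)]mulrA.
have : 2 * (L * K) * A <= l * A by rewrite ler_wpM2r // /l lerDl.
by move: (L * K) l => c m; lra.
Qed.

Let spread_base : spread (B + B).
Proof.
have B0 : 0 <= B by exact: le_trans (bndF 0).
move=> t x y v tT ox oy; apply: (@le_trans _ _ (B + B)).
  have [vq|qv] := leP `|v| q; last by rewrite !suppq // subrr normr0 addr_ge0.
  by rewrite !f_outer // (le_trans (ler_normB _ _)) // lerD.
rewrite ler_peMr ?addr_ge0 // -expR0 ler_expR mulr_ge0 ?(ltW l0) //.
by case/andP: tT.
Qed.

Let spread0 : spread 0.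
Proof.
have B0 : 0 <= B + B by rewrite addr_ge0 //; exact: le_trans (bndF 0).
have Hn n : spread ((B + B) / 2 ^+ n).
  elim: n => [|n IH]; first by rewrite expr0 divr1; exact: spread_base.
  rewrite exprSr invfM mulrA; apply: spread_half => //.
  by rewrite divr_ge0 // exprn_ge0.
move=> t x y v tT ox oy; rewrite mul0r leNgt; apply/negP => d0.
set d := `|_| in d0; set M := (B + B) * expR (l * t).
have Md n : M / 2 ^+ n >= d by rewrite /M mulrAC; exact: Hn.
have [n Hnd] : exists n, M / d < 2 ^+ n.
  exists (Num.bound (M / d)); rewrite (lt_le_trans (archi_boundP _)) //.
    by rewrite divr_ge0 // ?mulr_ge0 ?expR_ge0 // ltW.
  by rewrite -natrX ler_nat ltnW // ltn_expl.
have := Md n; rewrite ler_pdivlMr ?exprn_gt0 // mulrC -ler_pdivlMr //.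
by rewrite leNgt Hnd.
Qed.

Lemma field_constant_outer t x y : 0 <= t <= T -> outer t x -> outer t y ->
  E t x = E t y.
Proof.
move=> tT ox oy; apply/eqP; rewrite -subr_eq0 -normr_le0.
by have := field_spread (lexx 0) spread0 tT ox oy; rewrite mulr0 mul0r.
Qed.

Lemma rho_outer t x : 0 <= t <= T -> outer t x -> rho F f t x = 0.
Proof.
move=> tT ox.
have d1 := is_derive_field S x tT.
have d2 : is_derive x 1 (E t) 0.
  apply/is_derive1P => e e0; exists (ep * x - rch t); first by rewrite subr_gt0.
  move=> y yx; rewrite (field_constant_outer tT (outer_near ox yx) ox).
  by rewrite subrr mul0r subr0 normr0 mulr_ge0 // ltW.
by rewrite -(@derive_val _ _ _ _ _ _ _ d1) (@derive_val _ _ _ _ _ _ _ d2).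
Qed.

Lemma momentum_derivative_outer s t x v : 0 <= t <= T -> 0 <= s <= t ->
  outer t x -> `|v| < q -> is_derive v 1 (fun w => V s t x w) 1.
Proof.
move=> tT st ox vq; have sT : 0 <= s <= T.
  by case/andP: st tT => -> ? /andP[_]; exact: le_trans.
apply/is_derive1P => e e0; exists (q - `|v|); first by rewrite subr_gt0.
move=> w wv.
have wq : `|w| <= q.
  rewrite -[w](subrK v) (le_trans (ler_normD _ _)) //.
  by rewrite -lerBrDr ltW.
have [_ Vw dw] := ch x w tT; have [_ Vv dv] := ch x v tT.
have dD y : 0 <= y <= T -> has_derivative_within `[0, T]
    (fun y => V y t x w - V y t x v) y (- E y (X y t x w) - - E y (X y t x v)).
  by move=> yT; apply: has_derivative_withinB; [have [] := dw y yT|have [] := dv y yT].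
case/andP: (st) => s0 st'; case/andP: (tT) => t0 tT'.
have [c /andP[sc ct] Ec] := mean_value_within dD s0 st' tT'.
have cT : 0 <= c <= T by rewrite (le_trans s0) // (le_trans ct).
have c_t : 0 <= c <= t by rewrite (le_trans s0).
move: Ec; rewrite (@field_constant_outer c _ (X c t x v)) //; last 2 first.
- by apply: outer_characteristic => //; exact: ltW.
- by apply: outer_characteristic => //; exact: ltW.
rewrite subrr mul0r Vw Vv => /eqP; rewrite subr_eq0 => /eqP <-.
by rewrite mul1r subrr normr0 mulr_ge0 // ltW.
Qed.

End OuterRegion.

(** * Restriction to a shorter time interval, and the theorem *)

Section Restriction.
Context {R : realType}.
Local Notation mu := (@lebesgue_measure R).
Implicit Types (s t x y v T : R).

Lemma has_derivative_withinS (A B : set R) (h : R -> R) a l : B `<=` A ->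
  has_derivative_within A h a l -> has_derivative_within B h a l.
Proof.
move=> BA /has_derivative_withinP hl; apply/has_derivative_withinP => e /hl[d d0 hd].
by exists d => // y /BA; exact: hd.
Qed.

Lemma subset_itv0 t T : t <= T -> `[0, t] `<=` `[0, T].
Proof.
by move=> tT y /=; rewrite !in_itv/= => /andP[-> yt]; rewrite (le_trans yt).
Qed.

Lemma C1_strip_restrict t T f (ft fx fv : R -> R -> R -> R) : t <= T ->
  C1_strip_with T f ft fx fv -> C1_strip_with t f ft fx fv.
Proof.
move=> tT [df ct cx cv].
have sub : time_strip t `<=` time_strip T by move=> p; exact: subset_itv0.
split; [|exact: continuous_subspaceW ct|exact: continuous_subspaceW cx
        |exact: continuous_subspaceW cv].
move=> s x v /andP[s0 st]; have [|dt dx dv] := df s x v.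
  by rewrite s0 (le_trans st).
by split => //; apply: has_derivative_withinS dt; exact: subset_itv0.
Qed.

Lemma characteristics_restrict t T E (X V : R -> R -> R -> R -> R) : t <= T ->
  characteristics T E X V -> characteristics t E X V.
Proof.
move=> tT ch s x v /andP[s0 st]; have [|Xs Vs d] := ch s x v.
  by rewrite s0 (le_trans st).
split => // y /andP[y0 yt]; have [|dX dV] := d y; first by rewrite y0 (le_trans yt).
by split; [apply: has_derivative_withinS dX|apply: has_derivative_withinS dV];
  exact: subset_itv0.
Qed.

Lemma C1c_support (F : R -> R) : C1c F ->
  exists2 M : R, 0 < M & forall v, M <= `|v| -> F v = 0.
Proof.
move=> [_ _ /compact_bounded[M [_ HM]]].
have M1 : M < `|M| + 1 by rewrite ltr_pwDr // ler_norm.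
exists (`|M| + 2); first by rewrite ltr_wpDl.
move=> v Mv; apply/eqP; apply: contraPT Mv => Fv; apply/negP; rewrite -ltNge.
have /le_lt_trans-> // : `|v| <= `|M| + 1.
  by apply: (HM _ M1) => //; exact: subset_closure.
by rewrite ltrD2l ltr1n.
Qed.

(** F' is bounded on the support by compactness and vanishes off it. *)
Lemma C1c_lipschitz (F : R -> R) : C1c F ->
  exists2 L : R, 0 <= L & forall u v, `|F u - F v| <= L * `|u - v|.
Proof.
move=> F1; have [M M0 FM] := C1c_support F1; have [dF cF _] := F1.
have is_dF v : is_derive v 1 F (derive1 F v).
  by rewrite derive1E; exact/derivableP.
have NMM : - M <= M by rewrite ge0_cp // ltW.
have [c _ Hc] : exists2 c, c \in `[- M, M] &
    forall v, v \in `[- M, M] -> `|derive1 F v| <= `|derive1 F c|.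
  apply: (@EVT_max R (fun v => `|derive1 F v|) _ _ NMM).
  apply: continuous_subspaceT => v; apply: cvg_norm; exact: cF.
exists `|derive1 F c| => // u v.
have [w [_ ->]] := mean_value_near v u is_dF.
rewrite normrM ler_wpM2r //.
have [wM|Mw] := leP `|w| M.
  by apply: Hc; rewrite in_itv/= -ler_norml.
have d0 : is_derive w 1 F 0.
  apply/is_derive1P => e e0; exists (`|w| - M); first by rewrite subr_gt0.
  move=> y yw; rewrite !FM ?(ltW Mw) //.
    by rewrite subrr mul0r subrr normr0 mulr_ge0 // ltW.
  have := lerB_dist w y; rewrite distrC; move: yw; lra.
by rewrite -(@derive_val _ _ _ _ _ _ _ (is_dF w)) (@derive_val _ _ _ _ _ _ _ d0) normr0.
Qed.

End Restriction.

Theorem theorem1 (R : realType) (T : R) (F : R -> R) (f0 : R -> R -> R)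
    (f : R -> R -> R -> R) (E : R -> R -> R) (r C : R)
    (X V : R -> R -> R -> R -> R)
    (T_gt0 : 0 < T)
    (sol : VP_solution T F f0 f E)
    (hI : assumptionI r F f0)
    (hII : assumptionII C T E)
    (charXV : characteristics T E X V) :
  forall t x : R, 0 <= t <= T -> (Rad r F f E t < `|x|%:E)%E ->
    rho F f t x = 0 /\
    (forall s v : R, 0 <= s <= t -> (`|v|%:E <= Qg F f t)%E ->
       is_derive v 1 (fun w => V s t x w) 1).
Proof.
move=> t x tT xR.
have [r0 f0F [F1 _ _] _] := hI; have [C0 intE _] := hII.
have out0 y v : r < `|y| -> f 0 y v = F v by move=> ry; rewrite (VP_init sol) f0F.
have /andP[t0 tT'] := tT.
(* At t = 0 the factor t makes R(0) = r even if Q_g(0) is infinite. *)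
have [t_eq0|t_neq0] := eqVneq t 0.
  rewrite t_eq0 in xR *.
  have rx : r < `|x|.
    by move: xR; rewrite /Rad mul0e adde0 set_itv1 integral_set1 adde0 lte_fin.
  split.
    rewrite /rho (_ : pert F f 0 x = cst 0); first by rewrite /Rintegral integral0.
    by apply/funext => v; rewrite /pert out0 // subrr.
  move=> s v; rewrite -eq_le => /eqP <- _.
  rewrite (_ : (fun w => _) = id); first exact: is_derive_id.
  by apply/funext => w; have [|_ ->] := charXV 0 x w; rewrite ?lexx ?ltW.
have {t_neq0}t_gt0 : 0 < t by rewrite lt_neqAle eq_sym t_neq0.
have Q0 : (0 <= Qg F f t)%E by rewrite /Qg le_max lexx.
have J0 : (0 <= \int[lebesgue_measure]_(tau in `[0%R, t])
    \int[lebesgue_measure]_(s in `[tau, t]) supnorm (E s))%E.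
  by do 2 (apply: integral_ge0 => ? _); exact: supnorm_ge0.
have Qfin : Qg F f t \is a fin_num.
  rewrite ge0_fin_numE // ltey; apply/eqP => Qoo.
  move: xR; rewrite /Rad Qoo gt0_muley ?lte_fin // addey // addye ?ltNge ?leey //.
  by apply: contraTneq J0 => ->.
set q0 := fine (Qg F f t).
have Qq : Qg F f t = q0%:E by rewrite /q0 fineK.
have q0_ge0 : 0 <= q0 by exact: fine_ge0.
have suppq0 s y v : 0 <= s <= t -> q0 < `|v| -> f s y v = F v.
  move=> st qv; apply/esym/eqP; rewrite -subr_eq0; apply: contraPT qv => pv.
  apply/negP; rewrite -leNgt -lee_fin -Qq /Qg le_max; apply/orP; right.
  by apply: ereal_sup_ubound; exists v => //; exists y, s.
have [M M0 FM] := C1c_support F1.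
have [L L0 lipF] := C1c_lipschitz F1.
have [ft [fx [fv [C1 vla]]]] := VP_vlasov sol.
have sT s : 0 <= s <= t -> 0 <= s <= T.
  by move=> /andP[-> st]; rewrite (le_trans st).
pose P := Num.max M (q0 + 1).
have P0 : 0 < P by rewrite lt_max M0.
have FP v : P <= `|v| -> F v = 0 by rewrite ge_max => /andP[/FM].
have S : compact_momentum_solution t P F f E ft fx fv.
  split => //.
  - exact: C1_strip_restrict C1.
  - by move=> s y v /sT; exact: vla.
  - have [dF _ _] := F1 => v.
    by apply: differentiable_continuous; apply/derivable1_diffP; exact: dF.
  - move=> s y v st Pv; rewrite suppq0 //; first exact: FP.
    by rewrite (lt_le_trans _ Pv) // lt_max ltrDl ltr01 orbT.
  - by move=> s /sT; exact: (VP_rho_integrable sol).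
  - by move=> s y /sT; exact: (VP_field sol).
have ch := characteristics_restrict tT' charXV.
have intEt : lebesgue_measure.-integrable `[0, t] (fun tau => supnorm (E tau)).
  by apply: integrableS intE => //; exact: subset_itv0.
set J := \int[lebesgue_measure]_(tau in `[0, t]) impulse t E tau.
have RadE : Rad r F f E t = (r + t * q0 + J)%:E.
  rewrite /Rad Qq !EFinD EFinM; congr (_ + _)%E.
  rewrite /J /Rintegral fineK; last first.
    by apply: integrable_fin_num => //; exact: (impulse_integrable S intEt).
  apply: eq_integral => s; rewrite inE /= in_itv/= => st.
  by rewrite (impulse_fin intEt st).
have gap : r + t * q0 + J < `|x| by rewrite -lte_fin -RadE.
(* Half of the room between R(t) and |x| pays for momenta slightly above
   Q_g(t), so that a full neighbourhood of each v with |v| <= Q_g(t) is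
   controlled. *)
pose q := q0 + (`|x| - (r + t * q0 + J)) / (t + t).
have qq0 : q0 < q by rewrite ltrDl divr_gt0 ?subr_gt0 // addr_gt0.
have q_ge0 : 0 <= q by rewrite ltW // (le_lt_trans q0_ge0).
have suppq s y v : 0 <= s <= t -> q < `|v| -> f s y v = F v.
  by move=> st qv; rewrite suppq0 // (lt_trans qq0).
have bndF v : `|F v| <= L * (P + P).
  have [/FP->|vP] := leP P `|v|.
    by rewrite normr0 mulr_ge0 // addr_ge0 // ltW.
  rewrite -[F v]subr0 -(FP P); last by rewrite ler_norm.
  rewrite (le_trans (lipF _ _)) // ler_wpM2l // (le_trans (ler_normB _ _)) //.
  by rewrite (gtr0_norm P0) lerD2r ltW.
pose ep : R := if 0 <= x then 1 else -1.
have ep1 : `|ep| = 1 by rewrite /ep; case: ifP; rewrite ?normrN normr1.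
have epx : ep * x = `|x|.
  rewrite /ep; case: (leP 0 x) => x0; first by rewrite mul1r ger0_norm.
  by rewrite mulN1r ltr0_norm.
have ox : outer t E r q ep t x.
  rewrite /outer epx /reach -/J /q.
  have -> : r + t * (q0 + (`|x| - (r + t * q0 + J)) / (t + t)) + J =
      (r + t * q0 + J + `|x|) / 2.
    by field; rewrite gt_eqF // addr_gt0.
  by move: (r + t * q0 + J) gap => c gap; lra.
have tt : 0 <= t <= t by rewrite t0 lexx.
split.
  exact: (rho_outer S ch out0 intEt q_ge0 suppq L0 lipF bndF ep1 tt ox).
move=> s v st; rewrite Qq lee_fin => vq.
apply: (momentum_derivative_outer S ch out0 intEt q_ge0 suppq L0 lipF bndF ep1 tt st ox).
exact: le_lt_trans vq qq0.
Qed.
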